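(* Let $K$ be a field of characteristic $0$ and $GL_n=GL_n(K)$. An element $f\in\mathbb{Z}[t_1^{\pm1},\ldots,t_n^{\pm1}]^{S_n}[[q]]$ belongs to the $\mathbb{Z}$-submodule of $\mathbb{Z}[t_1^{\pm1},\ldots,t_n^{\pm1}]^{S_n}[[q]]$ generated by $\{\mathrm{ch}_Z(q)\mid Z\in\mathcal{C}\}$ if and only if $f$ is of the form \[ f=\frac{P(t_1,\ldots,t_n,q)}{\prod_{(\alpha,k)}(1-t_1^{\alpha_1}\cdots t_n^{\alpha_n}q^k)} \] where $P\in\mathbb{Z}[t_1^{\pm1},\ldots,t_n^{\pm1}][q]$ is a polynomial in $q$ and the product in the denominator ranges over a finite multiset of pairs $(\alpha,k)$ with $\alpha\in\mathbb{Z}^n$, $k\in\mathbb{N}_0$.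
   Context: Every representation $Z$ of $GL_n$ is a rational representation: a $K$-vector space with linear $GL_n$-action, spanned by finite dimensional $GL_n$-invariant subspaces, such that for each finite dimensional invariant subspace $U$ the map $GL_n\to GL(U)$ is a morphism of affine algebraic varieties. For a finite dimensional representation $\rho:GL_n\to GL(Z)$, the formal character $\mathrm{ch}_Z\in\mathbb{Z}[t_1^{\pm1},\ldots,t_n^{\pm1}]$ is the Laurent polynomial with $\mathrm{Tr}(\rho(\mathrm{diag}(z_1,\ldots,z_n)))=\mathrm{ch}_Z(z_1,\ldots,z_n)$ for all $z_1,\ldots,z_n\in K\setminus\{0\}$; it lies in the ring $\mathbb{Z}[t_1^{\pm1},\ldots,t_n^{\pm1}]^{S_n}$ of invariants of the symmetric group $S_n$ permuting the variables. Gradings are by $\mathbb{N}_0=\{0,1,2,\ldots\}$. A graded representation of $GL_n$ is a representation $Z=\bigoplus_{d=0}^\infty Z_d$ with each $Z_d$ finite dimensional and $GL_n$-invariant; its formal character is $\mathrm{ch}_Z(q)=\sum_{d=0}^\infty\mathrm{ch}_{Z_d}q^d\in\mathbb{Z}[t_1^{\pm1},\ldots,t_n^{\pm1}]^{S_n}[[q]]$. The class $\mathcal{C}$ consists of the graded representations $Z$ of $GL_n$ that also have the structure of a finitely generated graded module over the symmetric tensor algebra (polynomial algebra) $S(W)$ for some finite dimensional graded representation $W$ of $GL_n$ (with the grading on $S(W)$ induced by that of $W$), such that $g\cdot(fm)=(g\cdot f)(g\cdot m)$ for all $g\in GL_n$, $f\in S(W)$, $m\in Z$. The displayed form means that the denominator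 is nonzero (so the pair $(\alpha,k)=(0,0)$ does not occur) and $f$ times the denominator equals $P$ in $\mathbb{Z}[t_1^{\pm1},\ldots,t_n^{\pm1}][[q]]$. *)

(* Defs.v *)
From HB Require Import structures.
From mathcomp Require Import all_boot all_order all_algebra all_fingroup.
From mathcomp Require Import finmap mpoly.
From mathcomp Require monalg.

Set Implicit Arguments.
Unset Strict Implicit.
Unset Printing Implicit Defensive.

Import GRing.Theory.
Local Open Scope ring_scope.

(* monalg is imported in this module only: its notations clash with mpoly's. *)
Module LaurentPoly.
Import monalg.

(* The ring Z[t_1^{+-1}, ..., t_n^{+-1}], as finitely supported functions from
   exponent vectors to integers.  The ring structure that monalg puts on
   {malg R[M]} is not available here: it requires M to have no invertible
   element besides the unit, so the convolution product is defined directly. *)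
Definition laurent (n : nat) := monalg.malg 'rV[int]_n int.

HB.instance Definition _ n := GRing.Zmodule.on (laurent n).

Section LaurentRing.
Variable n : nat.
Implicit Types (p q r : laurent n) (a b : 'rV[int]_n).

Definition lcoef p a : int := monalg.mcoeff a p.

Definition lmon (c : int) a : laurent n := monalg.mkmalgU a c.

Definition lmul p q : laurent n :=
  \sum_(a <- monalg.msupp p) \sum_(b <- monalg.msupp q)
    lmon (lcoef p a * lcoef q b) (a + b).

Local Notation lone := (lmon 1 0).

Lemma lmon0 a : lmon 0 a = 0.
Proof. exact: monalg.monalgU0. Qed.

Lemma lmonD c1 c2 a : lmon (c1 + c2) a = lmon c1 a + lmon c2 a.
Proof. exact: monalg.monalgUD. Qed.

Lemma lcoefD p q a : lcoef (p + q) a = lcoef p a + lcoef q a.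
Proof. exact: monalg.mcoeffD. Qed.

Lemma lcoef_mon c a : lcoef (lmon c a) a = c.
Proof. exact: monalg.mcoeffUU. Qed.

Lemma laurentE p : p = \sum_(a <- monalg.msupp p) lmon (lcoef p a) a.
Proof. exact: monalg.monalgE. Qed.

Lemma lmulw (d1 d2 : {fset 'rV[int]_n}) p q :
  (monalg.msupp p `<=` d1)%fset -> (monalg.msupp q `<=` d2)%fset ->
  lmul p q = \sum_(a <- d1) \sum_(b <- d2) lmon (lcoef p a * lcoef q b) (a + b).
Proof.
move=> le1 le2; rewrite /lmul (big_fset_incl _ le1) /=.
  apply/eq_bigr=> a _; apply/big_fset_incl => // b _ /monalg.mcoeff_outdom.
  by rewrite /lcoef => ->; rewrite mulr0 lmon0.
move=> a _ /monalg.mcoeff_outdom pa.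
by rewrite big1 // => b _; rewrite /lcoef pa mul0r lmon0.
Qed.

Lemma lmulC : commutative lmul.
Proof.
move=> p q; rewrite /lmul exchange_big /=.
by apply: eq_bigr => a _; apply: eq_bigr => b _; rewrite mulrC addrC.
Qed.

Lemma lmulDl : left_distributive lmul +%R.
Proof.
move=> p q r.
rewrite (lmulw (monalg.msuppD_le p q) (fsubset_refl _)).
rewrite (lmulw (fsubsetUl _ (monalg.msupp q)) (fsubset_refl _)).
rewrite (lmulw (fsubsetUr (monalg.msupp p) _) (fsubset_refl _)).
rewrite -big_split /=; apply: eq_bigr => a _.
rewrite -big_split /=; apply: eq_bigr => b _.
by rewrite lcoefD mulrDl lmonD.
Qed.

Lemma lmulDr : right_distributive lmul +%R.
Proof. by move=> p q r; rewrite lmulC lmulDl !(lmulC _ p). Qed.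

Lemma lmul0p : left_zero 0 lmul.
Proof. by move=> p; rewrite /lmul monalg.msupp0 big_seq_fset0. Qed.

Lemma lmulp0 : right_zero 0 lmul.
Proof. by move=> p; rewrite lmulC lmul0p. Qed.

Lemma lmulUU c1 c2 a b : lmul (lmon c1 a) (lmon c2 b) = lmon (c1 * c2) (a + b).
Proof.
rewrite (lmulw (@monalg.msuppU_le _ _ a c1) (@monalg.msuppU_le _ _ b c2)).
by rewrite !big_seq_fset1 !lcoef_mon.
Qed.

Lemma lmul_suml (I : Type) (s : seq I) (F : I -> laurent n) q :
  lmul (\sum_(i <- s) F i) q = \sum_(i <- s) lmul (F i) q.
Proof. exact: (big_morph (lmul^~ q) (fun _ _ => lmulDl _ _ _) (lmul0p _)). Qed.

Lemma lmul_sumr (I : Type) (s : seq I) (F : I -> laurent n) q :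
  lmul q (\sum_(i <- s) F i) = \sum_(i <- s) lmul q (F i).
Proof. exact: (big_morph (lmul q) (fun _ _ => lmulDr _ _ _) (lmulp0 _)). Qed.

Lemma lmul1p : left_id lone lmul.
Proof.
move=> p; rewrite {1}[p]laurentE lmul_sumr [RHS]laurentE.
by apply: eq_bigr => a _; rewrite lmulUU mul1r add0r.
Qed.

Lemma lmulA : associative lmul.
Proof.
move=> p q r; rewrite [p]laurentE !lmul_suml; apply: eq_bigr => a _.
rewrite [q]laurentE lmul_suml !lmul_sumr lmul_suml; apply: eq_bigr => b _.
rewrite [r]laurentE !lmul_sumr; apply: eq_bigr => c _.
by rewrite !lmulUU mulrA addrA.
Qed.

Lemma lone_neq0 : lone != 0.
Proof.
by apply/eqP => /(congr1 (fun p => lcoef p 0)); rewrite lcoef_mon /lcoef monalg.mcoeff0.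
Qed.

HB.instance Definition _ := GRing.Zmodule_isComNzRing.Build (laurent n)
  lmulA lmulC lmul1p lmulDl lone_neq0.

Definition leval (K : fieldType) (z : 'I_n -> K) p : K :=
  \sum_(a <- monalg.msupp p) (lcoef p a)%:~R * \prod_(i < n) z i ^ a 0 i.

Definition lsym p : Prop :=
  forall (s : 'S_n) a, lcoef p (\row_i a 0 (s i)) = lcoef p a.

(* Power series in q over the Laurent polynomials, by their coefficients. *)
Definition pseries := nat -> laurent n.

Definition pser_mul (f h : pseries) : pseries :=
  fun d => \sum_(i < d.+1) f i * h (d - i)%N.

Definition pser_of_poly (P : {poly laurent n}) : pseries := fun d => P`_d.

Definition in_Zspan (S : pseries -> Prop) (f : pseries) : Prop :=
  exists (N : nat) (c : 'I_N -> int) (h : 'I_N -> pseries),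
    (forall i, S (h i)) /\ (forall d, f d = \sum_i h i d *~ c i).

Definition denom (s : seq ('rV[int]_n * nat)) : {poly laurent n} :=
  \prod_(ak <- s) (1 - (lmon 1 ak.1) *: 'X^(ak.2)).

End LaurentRing.

End LaurentPoly.
Export LaurentPoly.

Section FiniteDimension.
Variables (K : fieldType) (Z : lmodType K).

Definition is_basis (U : Z -> Prop) (m : nat) (b : 'I_m -> Z) : Prop :=
  (forall z, U z <-> exists c : 'I_m -> K, z = \sum_i c i *: b i) /\
  (forall c : 'I_m -> K, \sum_i c i *: b i = 0 -> forall i, c i = 0).

(* This forces U to be a linear subspace. *)
Definition fin_dim (U : Z -> Prop) : Prop :=
  exists (m : nat) (b : 'I_m -> Z), is_basis U b.

Definition mx_repr (m : nat) (b : 'I_m -> Z) (T : Z -> Z) (M : 'M[K]_m) : Prop :=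
  forall j, T (b j) = \sum_i M i j *: b i.

Definition has_trace (U : Z -> Prop) (T : Z -> Z) (t : K) : Prop :=
  exists (m : nat) (b : 'I_m -> Z) (M : 'M[K]_m),
    [/\ is_basis U b, mx_repr b T M & \tr M = t].

End FiniteDimension.

(* GL_n(K) is the set of g : 'M[K]_n with g \in unitmx; functions on it are
   functions on 'M[K]_n whose values off unitmx are irrelevant.  Its coordinate
   ring is K[x_ij, 1/det]. *)
Definition regular_GL (K : fieldType) (n : nat) (r : 'M[K]_n -> K) : Prop :=
  exists (p : {mpoly K[n * n]}) (k : nat),
    forall g, g \in unitmx -> r g = p.@[fun i => mxvec g 0 i] / \det g ^+ k.

Definition morphism_GL (K : fieldType) (n m : nat) (rho : 'M[K]_n -> 'M[K]_m) : Prop :=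
  (forall g, g \in unitmx -> rho g \in unitmx) /\
  (forall r, regular_GL r -> regular_GL (fun g => r (rho g))).

Section Representations.
Variables (K : fieldType) (n : nat).

Section OnModule.
Variables (Z : lmodType K) (act : 'M[K]_n -> Z -> Z).

Definition GL_action : Prop :=
  [/\ forall g, g \in unitmx -> linear (act g),
      forall z, act 1%:M z = z
    & forall g h z, g \in unitmx -> h \in unitmx ->
        act (g *m h) z = act g (act h z)].

Definition GL_invariant (U : Z -> Prop) : Prop :=
  forall g z, g \in unitmx -> U z -> U (act g z).

Definition rational_rep : Prop :=
  [/\ GL_action,
      forall z, exists (N : nat) (u : 'I_N -> Z), z = \sum_i u i /\
        forall i, exists U, [/\ fin_dim U, GL_invariant U & U (u i)]
    & forall (U : Z -> Prop) (m : nat) (b : 'I_m -> Z),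
        is_basis U b -> GL_invariant U ->
        exists2 rho : 'M[K]_n -> 'M[K]_m, morphism_GL rho &
          forall g, g \in unitmx -> mx_repr b (act g) (rho g)].

Definition formal_char (U : Z -> Prop) (chi : laurent n) : Prop :=
  forall z : 'I_n -> K, (forall i, z i != 0) ->
    has_trace U (act (diag_mx (\row_i z i))) (leval z chi).

End OnModule.

Definition direct_decomp (Z : lmodType K) (comp : nat -> Z -> Prop) : Prop :=
  (forall z, exists (N : nat) (x : nat -> Z),
     (forall d, comp d (x d)) /\ z = \sum_(d < N) x d) /\
  (forall (N : nat) (x : nat -> Z), (forall d, comp d (x d)) ->
     \sum_(d < N) x d = 0 -> forall d, (d < N)%N -> x d = 0).

Record gradedRep := GradedRep {
  gr_car :> lmodType K;
  gr_act : 'M[K]_n -> gr_car -> gr_car;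
  gr_comp : nat -> gr_car -> Prop;
  gr_rational : rational_rep gr_act;
  gr_fin_dim : forall d, fin_dim (gr_comp d);
  gr_invariant : forall d, GL_invariant gr_act (gr_comp d);
  gr_direct : direct_decomp gr_comp
}.

Definition graded_char (Z : gradedRep) (chi : pseries n) : Prop :=
  forall d, formal_char (@gr_act Z) (@gr_comp Z d) (chi d).

(* For a basis w_1, ..., w_m of W, the symmetric algebra S(W) is {mpoly K[m]}
   with w_j identified with 'X_j.  If the w_j are homogeneous of degrees e_j,
   then S(W)_k is spanned by the monomials of weighted degree k. *)
Definition sym_homog (m : nat) (e : 'I_m -> nat) (k : nat) (p : {mpoly K[m]}) : Prop :=
  forall mu : 'X_{1..m}, mu \in msupp p -> (\sum_i e i * mu i)%N = k.

(* The algebra endomorphism of S(W) induced by the endomorphism of W with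
   matrix M, i.e. sending w_j to \sum_i M i j *: w_i. *)
Definition sym_act (m : nat) (M : 'M[K]_m) (p : {mpoly K[m]}) : {mpoly K[m]} :=
  p \mPo [tuple \sum_i M i j *: 'X_i | j < m].

Definition sym_module (m : nat) (Z : lmodType K)
    (smul : {mpoly K[m]} -> Z -> Z) : Prop :=
  [/\ forall p q z, smul (p + q) z = smul p z + smul q z,
      forall p y z, smul p (y + z) = smul p y + smul p z,
      forall p q z, smul (p * q) z = smul p (smul q z)
    & forall (c : K) z, smul c%:MP z = c *: z].

Definition fin_gen (m : nat) (Z : lmodType K)
    (smul : {mpoly K[m]} -> Z -> Z) : Prop :=
  exists (r : nat) (y : 'I_r -> Z), forall z,
    exists p : 'I_r -> {mpoly K[m]}, z = \sum_i smul (p i) (y i).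

Definition classC (Z : gradedRep) : Prop :=
  exists (W : gradedRep) (m : nat) (w : 'I_m -> W) (e : 'I_m -> nat)
         (smul : {mpoly K[m]} -> Z -> Z),
    is_basis (fun _ : W => True) w /\
    (forall j, @gr_comp W (e j) (w j)) /\
    sym_module smul /\
    (forall k d p z, sym_homog e k p -> @gr_comp Z d z ->
       @gr_comp Z (k + d)%N (smul p z)) /\
    fin_gen smul /\
    (forall g M, g \in unitmx -> mx_repr w (@gr_act W g) M -> forall p z,
       @gr_act Z g (smul p z) = smul (sym_act M p) (@gr_act Z g z)).

End Representations.

(* Main.v *)
From HB Require Import structures.
From mathcomp Require Import all_boot all_order all_algebra all_fingroup.
From mathcomp Require Import finmap mpoly mxtens.
From mathcomp Require monalg.
From mathcomp Require Import boolp.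
Require Import Defs.

(** From characters to fractions.  A sum of fractions is a fraction, so let Z be
    a finitely generated graded module over S(W) with a compatible action.
    Restricted to the diagonal torus, the matrix coefficients of a
    representation are Laurent polynomials; since the characters t^a of the
    torus are linearly independent in characteristic 0, every vector is a sum of
    weight vectors ([weight_decomposition]).  Hence finitely many weight vectors
    generate Z, and S(W) acts through finitely many commuting operators u, each
    with a weight a and a degree k.  The operators with k = 0 preserve the finite
    dimensional low-degree part, so they are absorbed into the generators
    ([class_char_rational]).  Order the products of a monomial in the remaining
    operators with a generator lexicographically and call such a product standard
    if it is not a combination of smaller ones of its degree.  The standard
    products are a basis of weight vectors of each Z_d ([standard_trace]), so
    ch_Z is the sum of their weights; for a fixed generator they form an order
    ideal of N^m ([standard_down_closed]).  Since order ideals satisfy the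
    descending chain condition ([down_sets_dcc]), peeling off one variable at a
    time shows that the generating function of an order ideal times the product
    of all 1 - t^a q^k is a polynomial ([gen_fun_rational],
    [equivariant_hilbert_series]).

    From fractions to characters.  Let f = P / denom s with f symmetric.  The
    factors 1 - t^a are regular and can be stripped off ([strip_degree0]).  Every
    exponent a is a weight of some representation ([weight_occurs]), so the
    remaining denominator divides D = 1 / ch S(W) for a suitable W in positive
    degrees ([denom_divides_sym_denom]), and f D = Q is a polynomial in q.  The
    coefficients of D are virtual characters, being obtained by inverting the
    power series ch S(W) ([sym_denom_virtual]); so they are symmetric, and with
    them the coefficients of Q.  A symmetric Laurent polynomial p is a virtual
    character ([lsym_virtual]): by the fundamental theorem of symmetric
    polynomials it is a polynomial in det^-1 and the elementary symmetric
    polynomials, and the latter are, up to sign, the coefficients of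
    1 / ch S(K^n).  Finally, for p the character of a representation V, the
    series p q^k / D is the character of the free module S(W) (x) V, with V in
    degree k ([virtual_over_sym_denom]); summing over the coefficients of Q gives
    f = Q / D. *)

Set Implicit Arguments.
Unset Strict Implicit.
Unset Printing Implicit Defensive.

Import Order.TTheory GRing.Theory Num.Theory.
Local Open Scope ring_scope.

(** * Laurent polynomials and their evaluation on the torus *)

(** Coefficients and monomials are sealed: Laurent polynomials are finite maps
    keyed by integer matrices, and comparing two of them up to conversion would
    otherwise compute in these maps. *)
HB.lock Definition coef_at n (a : 'rV[int]_n) (p : laurent n) : int := lcoef p a.
HB.lock Definition tmon n (a : 'rV[int]_n) : laurent n := lmon 1 a.
Arguments coef_at {n} a p.
Arguments tmon {n} a.

Section LaurentTheory.
Variable n : nat.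
Implicit Types (p q : laurent n) (a b : 'rV[int]_n).

Lemma coef_atE p a : coef_at a p = lcoef p a.
Proof. by rewrite unlock. Qed.

Lemma coef_at_lmon c a b : coef_at b (lmon c a) = c *+ (a == b).
Proof. by rewrite unlock; apply: monalg.mcoeffU. Qed.

Lemma laurentP p q : (forall a, coef_at a p = coef_at a q) -> p = q.
Proof. by rewrite unlock => h; apply/monalg.malgP. Qed.

Lemma coef_at_is_zmod_morphism a : zmod_morphism (coef_at a).
Proof. by rewrite unlock => p q; rewrite lcoefD; congr (_ + _); apply: monalg.mcoeffN. Qed.

HB.instance Definition _ a := GRing.isZmodMorphism.Build (laurent n) int
  (coef_at a) (coef_at_is_zmod_morphism a).

Lemma coef_at0 a : coef_at a (0 : laurent n) = 0.
Proof. exact: (raddf0 (coef_at a)). Qed.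

Lemma coef_atB p q a : coef_at a (p - q) = coef_at a p - coef_at a q.
Proof. exact: coef_at_is_zmod_morphism. Qed.

Lemma coef_at_sum (I : Type) (r : seq I) (P : pred I) (F : I -> laurent n) a :
  coef_at a (\sum_(i <- r | P i) F i) = \sum_(i <- r | P i) coef_at a (F i).
Proof. exact: (raddf_sum (coef_at a)). Qed.

Lemma coef_atMz p c a : coef_at a (p *~ c) = coef_at a p *~ c.
Proof. exact: (raddfMz (coef_at a)). Qed.

Lemma lmonM c d a b : lmon c a * lmon d b = lmon (c * d) (a + b).
Proof. exact: lmulUU. Qed.

Lemma tmonE a : tmon a = lmon 1 a.
Proof. by rewrite unlock. Qed.

Lemma tmon0 : tmon 0 = 1 :> laurent n.
Proof. exact: tmonE. Qed.

Lemma tmonD a b : tmon (a + b) = tmon a * tmon b.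
Proof. by rewrite !tmonE lmonM. Qed.

Lemma tmonX a k : tmon a ^+ k = tmon (a *+ k).
Proof.
by elim: k => [|k IHk]; [rewrite tmon0 | rewrite exprS IHk -tmonD mulrS].
Qed.

Lemma tmon_sum (I : Type) (r : seq I) (P : pred I) (F : I -> 'rV[int]_n) :
  tmon (\sum_(i <- r | P i) F i) = \prod_(i <- r | P i) tmon (F i).
Proof. by apply: (big_morph tmon); [apply: tmonD | apply: tmon0]. Qed.

Lemma coef_at_tmon a b : coef_at b (tmon a) = (a == b)%:R.
Proof. by rewrite tmonE coef_at_lmon. Qed.

Lemma lmon_tmon c a : lmon c a = tmon a *~ c.
Proof.
apply: laurentP => b; rewrite coef_atMz coef_at_tmon coef_at_lmon.
by case: (a == b); rewrite /= ?mul0rz ?mulr1n ?mulr0n ?intz.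
Qed.

Lemma laurent_tmonE p :
  p = \sum_(a <- enum_fset (monalg.msupp p)) tmon a *~ coef_at a p.
Proof. by rewrite {1}[p]laurentE; apply: eq_bigr => a _; rewrite lmon_tmon coef_atE. Qed.

Lemma coef_at_monM a p b : coef_at b (tmon a * p) = coef_at (b - a) p.
Proof.
rewrite {1}[p]laurent_tmonE mulr_sumr coef_at_sum.
rewrite [in RHS](laurent_tmonE p) coef_at_sum; apply: eq_bigr => c _.
rewrite mulrzAr -tmonD !coef_atMz !coef_at_tmon [a + c]addrC.
by rewrite (can2_eq (addrK a) (subrK a)).
Qed.

(** Multiplication by t^a moves the support along a, and a nonempty finite
    set of exponents is not stable under translation by a nonzero a. *)
Lemma one_sub_mon_regular a p : a != 0 -> (1 - tmon a) * p = 0 -> p = 0.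
Proof.
move=> a0; rewrite mulrBl mul1r => /(canRL (subrK _)); rewrite add0r => pE.
have step k b : coef_at b p = coef_at (b - a *+ k) p.
  elim: k => [|k ->]; first by rewrite mulr0n subr0.
  by rewrite {1}pE coef_at_monM mulrSr opprD addrA.
apply: laurentP => b; rewrite coef_at0; apply/eqP/negP => /negP pb.
have [S Ssub] : exists S : seq 'rV[int]_n, forall c, coef_at c p != 0 -> c \in S.
  exists (enum_fset (monalg.msupp p)) => c.
  by rewrite unlock -monalg.mcoeff_neq0.
pose T := [seq b - a *+ k | k <- iota 0 (size S).+1].
have uT : uniq T.
  rewrite map_inj_uniq ?iota_uniq // => k l /addrI /oppr_inj.
  have [i ai] : exists i, a 0 i != 0.
    apply/existsP; apply: contraNT a0 => /existsPn h; apply/eqP/rowP => i.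
    by rewrite mxE; apply/eqP; have := h i; rewrite negbK.
  by move=> /rowP /(_ i); rewrite !mulmxnE => /(mulrIn ai).
have : (size T <= size S)%N.
  apply: uniq_leq_size uT _ => c /mapP[k _ ->].
  by apply: Ssub; rewrite -step.
by rewrite size_map size_iota ltnn.
Qed.

End LaurentTheory.

Section Evaluation.
Variables (K : fieldType) (n : nat).
Implicit Types (p q : laurent n) (a b : 'rV[int]_n) (z : 'I_n -> K).

Definition zpow z a : K := \prod_(i < n) z i ^ a 0 i.

Lemma zpow0 z : zpow z 0 = 1.
Proof. by rewrite /zpow big1 // => i _; rewrite mxE expr0z. Qed.

Lemma zpowD z a b : (forall i, z i != 0) -> zpow z (a + b) = zpow z a * zpow z b.
Proof.
move=> z0; rewrite /zpow -big_split; apply: eq_bigr => i _.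
by rewrite mxE expfzDr.
Qed.

Lemma zpow_neq0 z a : (forall i, z i != 0) -> zpow z a != 0.
Proof. by move=> z0; apply/prodf_neq0 => i _; rewrite expfz_neq0. Qed.

Lemma zpowM z z' a : zpow (fun i => z i * z' i) a = zpow z a * zpow z' a.
Proof. by rewrite -big_split; apply: eq_bigr => i _; rewrite expfzMl. Qed.

Lemma zpow_muln z a k : (forall i, z i != 0) -> zpow z (a *+ k) = zpow z a ^+ k.
Proof.
by move=> z0; elim: k => [|k IHk]; rewrite ?zpow0 // mulrS zpowD // IHk exprS.
Qed.

Lemma zpow_perm z a (s : 'S_n) :
  zpow (fun i => z (s i)) a = zpow z (\row_i a 0 ((s^-1)%g i)).
Proof.
rewrite /zpow [RHS](reindex_inj (@perm_inj _ s)); apply: eq_bigr => i _.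
by rewrite mxE permK.
Qed.

Lemma levalE z p :
  leval z p = \sum_(a <- enum_fset (monalg.msupp p)) (lcoef p a)%:~R * zpow z a.
Proof. by []. Qed.

Lemma leval_wide (d : {fset 'rV[int]_n}) z p : (monalg.msupp p `<=` d)%fset ->
  leval z p = \sum_(a <- d) (lcoef p a)%:~R * zpow z a.
Proof.
move=> le; rewrite /leval (big_fset_incl _ le) // => a _ /monalg.mcoeff_outdom.
by rewrite /lcoef => ->; rewrite mul0r.
Qed.

Lemma levalD z p q : leval z (p + q) = leval z p + leval z q.
Proof.
rewrite (leval_wide z (monalg.msuppD_le p q)).
rewrite (leval_wide z (fsubsetUl _ (monalg.msupp q))).
rewrite (leval_wide z (fsubsetUr (monalg.msupp p) _)).
by rewrite -big_split; apply: eq_bigr => a _; rewrite lcoefD rmorphD mulrDl.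
Qed.

Lemma leval0 z : leval z (0 : laurent n) = 0.
Proof. by rewrite /leval monalg.msupp0 big_seq_fset0. Qed.

Lemma leval_sum (I : Type) (r : seq I) (P : pred I) (F : I -> laurent n) z :
  leval z (\sum_(i <- r | P i) F i) = \sum_(i <- r | P i) leval z (F i).
Proof. exact: (big_morph _ (levalD z) (leval0 z)). Qed.

Lemma leval_mon c z a : leval z (lmon c a) = c%:~R * zpow z a.
Proof.
by rewrite (leval_wide z (@monalg.msuppU_le _ _ a c)) big_seq_fset1 lcoef_mon.
Qed.

Lemma leval_tmon z a : leval z (tmon a) = zpow z a.
Proof. by rewrite tmonE leval_mon mul1r. Qed.

Lemma levalN z p : leval z (- p) = - leval z p.
Proof. by apply/eqP; rewrite -addr_eq0 -levalD addNr leval0. Qed.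

Lemma levalM z p q : (forall i, z i != 0) ->
  leval z (p * q) = leval z p * leval z q.
Proof.
move=> z0; rewrite [in LHS](laurentE p) [in LHS](laurentE q) mulr_suml leval_sum.
rewrite (levalE z p) (levalE z q) mulr_suml.
apply: eq_bigr => a _; rewrite mulr_sumr leval_sum mulr_sumr.
apply: eq_bigr => b _.
by rewrite lmonM leval_mon zpowD // rmorphM mulrACA.
Qed.

Lemma leval_prod (I : Type) (s : seq I) (F : I -> laurent n) z :
  (forall i, z i != 0) ->
  leval z (\prod_(i <- s) F i) = \prod_(i <- s) leval z (F i).
Proof.
move=> z0; elim: s => [|i s IH]; last by rewrite !big_cons levalM // IH.
by rewrite !big_nil -tmon0 leval_tmon zpow0.
Qed.

Hypothesis charK : [pchar K] =i pred0.

Lemma natf_eq0 (k : nat) : (k%:R == 0 :> K) = (k == 0)%N.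
Proof. exact: (pcharf0P K).1 charK k. Qed.

Lemma intf_eq0 (c : int) : (c%:~R == 0 :> K) = (c == 0).
Proof. by case: c => k; rewrite ?NegzE ?rmorphN ?oppr_eq0 ?intr_eq0 /= -?pmulrn natf_eq0. Qed.

Lemma zpow_separates a b : a != b ->
  exists2 z : 'I_n -> K, forall i, z i != 0 & zpow z a != zpow z b.
Proof.
move=> ab; have [i ai] : exists i, a 0 i != b 0 i.
  apply/existsP; apply: contraNT ab => /existsPn h; apply/eqP/rowP => i.
  by apply/eqP; have := h i; rewrite negbK.
pose z j : K := if j == i then 2%:R else 1.
have two : 2%:R != 0 :> K by rewrite natf_eq0.
have zE c : zpow z c = 2%:R ^ c 0 i.
  rewrite /zpow (bigD1 i) //= big1 ?mulr1 /z ?eqxx // => j /negPf ->.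
  by rewrite exp1rz.
exists z => [j|]; first by rewrite /z; case: ifP => _; rewrite ?two ?oner_neq0.
(* In characteristic 0 the element 2 has infinite multiplicative order. *)
rewrite !zE -subr_eq0; apply: contra ai => /eqP h.
have pw (k : nat) : (2%:R : K) ^+ k = 1 -> k = 0%N.
  move=> /eqP; rewrite -natrX -(subr_eq0 _ 1) -(natrB _ (m := 2 ^ k) (n := 1)) ?expn_gt0 //.
  by rewrite natf_eq0 subn_eq0 -{2}(expn0 2) leq_exp2l // leqn0 => /eqP.
have {h} : (2%:R : K) ^ (a 0 i - b 0 i) = 1.
  have h' : (2%:R : K) ^ a 0 i = 2%:R ^ b 0 i by apply/eqP; rewrite -subr_eq0 h.
  by rewrite expfzDr // h' -expfzDr // subrr expr0z.
rewrite -(subr_eq0 (a 0 i)).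
case: (a 0 i - b 0 i) => k; first by rewrite -exprnP => /pw ->.
by rewrite NegzE -exprnN => /(congr1 GRing.inv); rewrite invrK invr1 => /pw.
Qed.

(** Dedekind's independence of characters, with coefficients in any vector
    space: subtracting z0^a times a relation from its translate by z0 removes the
    term of a and multiplies that of b by z0^b - z0^a. *)
Lemma zpow_independent (Z : lmodType K) (s : seq 'rV[int]_n) (v : 'rV[int]_n -> Z) :
  uniq s ->
  (forall z, (forall i, z i != 0) -> \sum_(a <- s) zpow z a *: v a = 0) ->
  forall a, a \in s -> v a = 0.
Proof.
elim: s v => [//|a s IHs] v /= /andP[as_ us] vanish.
have tl b : b \in s -> v b = 0.
  move=> bs; have ab : b != a by apply: contraNneq as_ => <-.
  have [z0 z0n0 zab] := zpow_separates ab.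
  pose w c := (zpow z0 c - zpow z0 a) *: v c.
  have : w b = 0.
    apply: IHs => // z zn0.
    have h1 : \sum_(c <- a :: s) zpow (fun i => z0 i * z i) c *: v c = 0.
      by apply: vanish => i; rewrite mulf_neq0.
    have h2 : zpow z0 a *: (\sum_(c <- a :: s) zpow z c *: v c) = 0.
      by rewrite vanish ?scaler0.
    move: h1; rewrite -[RHS]h2 scaler_sumr => /eqP.
    rewrite -subr_eq0 -sumrB big_cons zpowM scalerA subrr add0r => /eqP E.
    rewrite -[RHS]E.
    by apply: eq_bigr => c _; rewrite zpowM /w !scalerA -scalerBl mulrBr mulrC (mulrC (zpow z c)).
  by move/eqP; rewrite scaler_eq0 subr_eq0 (negPf zab) => /eqP.
move=> b; rewrite inE => /predU1P[->|]; last exact: tl.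
have := vanish (fun=> 1) (fun=> oner_neq0 K); rewrite big_cons big_seq big1 => [|c /tl ->].
  rewrite addr0 => /eqP; rewrite scaler_eq0 (negPf (zpow_neq0 _ _)) //= => [/eqP //|i].
  exact: oner_neq0.
by rewrite scaler0.
Qed.

Lemma leval_inj p q :
  (forall z : 'I_n -> K, (forall i, z i != 0) -> leval z p = leval z q) -> p = q.
Proof.
move=> h; apply/eqP; rewrite -subr_eq0; apply/eqP; set r := p - q.
have r0 a : a \in enum_fset (monalg.msupp r) -> (lcoef r a)%:~R = 0 :> K^o.
  apply: (@zpow_independent K^o _ (fun a => (lcoef r a)%:~R)) => [|z z0]; first exact: fset_uniq.
  have : leval z r = 0 by rewrite levalD levalN h // subrr.
  by rewrite levalE => E; rewrite -[RHS]E; apply: eq_bigr => b _; rewrite [RHS]mulrC.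
apply: laurentP => a; rewrite coef_at0 coef_atE.
case: (boolP (a \in monalg.msupp r)) => [/r0/eqP|]; first by rewrite intf_eq0 => /eqP.
by move/monalg.mcoeff_outdom.
Qed.

(** Symmetry read off from values, where products are harmless. *)
Lemma lsym_leval p : lsym p <->
  (forall (s : 'S_n) z, (forall i, z i != 0) -> leval (fun i => z (s i)) p = leval z p).
Proof.
pose sh (s : 'S_n) (q : laurent n) : laurent n :=
  \sum_(a <- monalg.msupp q) lmon (lcoef q a) (\row_i a 0 ((s^-1)%g i)).
have shE s q a : coef_at a (sh s q) = coef_at (\row_i a 0 (s i)) q.
  rewrite coef_at_sum [in RHS](laurentE q) coef_at_sum; apply: eq_bigr => b _.
  rewrite !coef_at_lmon; congr (_ *+ nat_of_bool _); apply/eqP/eqP => [<-|->];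
    by apply/rowP => i; rewrite !mxE ?permK ?permKV.
have shev s q z : (forall i, z i != 0) -> leval z (sh s q) = leval (fun i => z (s i)) q.
  move=> z0; rewrite leval_sum levalE; apply: eq_bigr => a _.
  by rewrite leval_mon zpow_perm.
split=> [psym s z z0|pinv s a].
  by rewrite -shev //; congr (leval z _); apply: laurentP => a; rewrite shE !coef_atE psym.
by rewrite -!coef_atE -shE; congr (coef_at a _); apply: leval_inj => z z0; rewrite shev // pinv.
Qed.

Lemma lsymM p q : lsym p -> lsym q -> lsym (p * q).
Proof.
move=> /lsym_leval hp /lsym_leval hq; apply/lsym_leval => s z z0.
by rewrite !levalM // hp ?hq.
Qed.

End Evaluation.

Lemma lsym_sum (n : nat) (I : Type) (r : seq I) (F : I -> laurent n) :
  (forall i, lsym (F i)) -> lsym (\sum_(i <- r) F i).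
Proof.
move=> h s a; rewrite -!coef_atE !coef_at_sum; apply: eq_bigr => i _.
by rewrite !coef_atE h.
Qed.

(** * Products of power series and polynomials *)

HB.lock Definition smulp (R : comNzRingType) (f : nat -> R) (P : {poly R}) : nat -> R :=
  fun d => \sum_(i < d.+1) f i * P`_(d - i).

Section PowerSeries.
Variable R : comNzRingType.
Implicit Types (f g h : nat -> R) (P Q D : {poly R}).

Lemma smulp_sum f P d : smulp f P d = \sum_(i < d.+1) f i * P`_(d - i).
Proof. by rewrite unlock. Qed.

Lemma smulpE f P d N : (d < N)%N -> smulp f P d = (\poly_(i < N) f i * P)`_d.
Proof.
move=> dN; rewrite coefM smulp_sum; apply: eq_bigr => i _.
by rewrite coef_poly (leq_ltn_trans (leq_ord i) dN).
Qed.

Lemma eq_smulp f g P : f =1 g -> smulp f P =1 smulp g P.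
Proof. by move=> fg d; rewrite !smulp_sum; apply: eq_bigr => i _; rewrite fg. Qed.

Lemma smulpA f P Q d : smulp (smulp f P) Q d = smulp f (P * Q) d.
Proof.
rewrite [RHS](smulpE _ _ (ltnSn d)) mulrA coefM smulp_sum; apply: eq_bigr => i _.
by rewrite (smulpE _ _ (ltn_ord i)).
Qed.

Lemma smulp_poly P Q d : smulp (fun i => P`_i) Q d = (P * Q)`_d.
Proof. by rewrite coefM smulp_sum. Qed.

Lemma smulpDl f g P d : smulp (fun i => f i + g i) P d = smulp f P d + smulp g P d.
Proof.
by rewrite !smulp_sum -big_split; apply: eq_bigr => i _; rewrite mulrDl.
Qed.

Lemma smulpMzl f c P d : smulp (fun i => f i *~ c) P d = smulp f P d *~ c.
Proof.
rewrite !smulp_sum mulrz_suml; apply: eq_bigr => i _.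
by rewrite mulrzAl.
Qed.

Lemma smulpBr f P Q d : smulp f (P - Q) d = smulp f P d - smulp f Q d.
Proof.
rewrite !smulp_sum -sumrB; apply: eq_bigr => i _.
by rewrite coefB mulrBr.
Qed.

Lemma smulp1 f d : smulp f 1 d = f d.
Proof.
rewrite smulp_sum big_ord_recr /= subnn coef1 mulr1.
rewrite big1 ?add0r // => i _; rewrite coef1 subn_eq0 leqNgt ltn_ord.
by rewrite mulr0.
Qed.

Lemma smulp_monX f p k d :
  smulp f (p *: 'X^k) d = if (k <= d)%N then p * f (d - k)%N else 0.
Proof.
rewrite (smulpE _ _ (ltnSn d)) -scalerAr coefZ coefMXn ltnNge.
case: leqP => kd /=; last by rewrite mulr0.
by rewrite coef_poly ltnS leq_subr.
Qed.

Lemma smulp_cancel D f g : D`_0 = 1 -> smulp f D =1 smulp g D -> f =1 g.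
Proof.
move=> D0 fg d; elim/ltn_ind: d => d IHd; have := fg d.
have top h : smulp h D d = \sum_(i < d) h i * D`_(d - i) + h d.
  by rewrite smulp_sum big_ord_recr /= subnn D0 mulr1.
have low : \sum_(i < d) f i * D`_(d - i) = \sum_(i < d) g i * D`_(d - i).
  by apply: eq_bigr => i _; rewrite IHd.
by rewrite (top f) (top g) low => /addrI.
Qed.

End PowerSeries.

Section Denominators.
Variable n : nat.

Lemma smulp_pser (f : pseries n) P : pser_mul f (pser_of_poly P) = smulp f P.
Proof. by rewrite unlock. Qed.

Lemma denom_cons ak s :
  denom (ak :: s) = (1 - tmon ak.1 *: 'X^(ak.2)) * denom s :> {poly laurent n}.
Proof. by rewrite tmonE; apply: big_cons. Qed.

Lemma denom_cat s1 s2 : denom (s1 ++ s2) = denom s1 * denom s2 :> {poly laurent n}.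
Proof. exact: big_cat. Qed.

Lemma denom_coef0 s : all (fun ak => 0 < ak.2)%N s -> (denom s : {poly laurent n})`_0 = 1.
Proof.
elim: s => [|[a [//|k]] s IHs] /=; first by rewrite /denom big_nil coef1.
by move=> /IHs h; rewrite denom_cons coef0M coefB coefZ coefXn coef1 h /= mulr0 subr0 mul1r.
Qed.

End Denominators.

(** * Generating functions of order ideals of monomials *)

Section DownSets.
Implicit Types (B : pred (seq nat)) (mu nu : seq nat).

Definition down_closed (m : nat) B : Prop :=
  forall mu nu, size mu = m -> size nu = m -> all2 leq mu nu -> B nu -> B mu.

Definition slice B a : pred (seq nat) := fun mu => B (a :: mu).

Definition shift B : pred (seq nat) :=
  fun mu => if mu is a :: mu' then B (a.+1 :: mu') else false.

Lemma all2_leq_refl mu : all2 leq mu mu.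
Proof. by elim: mu => //= a mu ->; rewrite leqnn. Qed.

Lemma down_slice m B a : down_closed m.+1 B -> down_closed m (slice B a).
Proof.
by move=> dB mu nu smu snu le; apply: dB; rewrite /= ?smu ?snu ?leqnn.
Qed.

Lemma down_shift m B : down_closed m.+1 B -> down_closed m.+1 (shift B).
Proof.
move=> dB [|a mu] [|b nu] //= [smu] [snu] /andP[ab le].
by apply: dB; rewrite /= ?smu ?snu ?ltnS ?ab.
Qed.

Lemma slice_le m B a b mu : down_closed m.+1 B -> size mu = m -> (a <= b)%N ->
  B (b :: mu) -> B (a :: mu).
Proof. by move=> dB smu ab; apply: dB; rewrite /= ?smu ?ab ?all2_leq_refl. Qed.

(** Dickson's lemma, for order ideals.  In N^(m+1), the diagonal slices of a
    descending chain themselves descend, hence stabilize from some K on, which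
    takes care of all slices from K on; the finitely many remaining slices
    stabilize one by one. *)
Lemma down_sets_dcc m (B : nat -> pred (seq nat)) :
    (forall k, down_closed m (B k)) ->
    (forall k mu, size mu = m -> B k.+1 mu -> B k mu) ->
  exists K, forall k mu, (K <= k)%N -> size mu = m -> B k mu = B K mu.
Proof.
elim: m B => [|m IHm] B dB dec.
  have [[K BK]|/forallNP allB] := pselect (exists K, ~~ B K [::]).
    exists K => k mu Kk /size0nil ->; apply/idP/idP; last by rewrite (negPf BK).
    by elim: k Kk => [|k IHk]; [rewrite leqn0 => /eqP-> | rewrite leq_eqVlt => /predU1P[->//|/IHk IH /dec-/(_ erefl)]].
  by exists 0%N => k mu _ /size0nil ->; have /negP := allB k; have /negP := allB 0%N; rewrite !negbK => -> ->.
have decl k l mu : (k <= l)%N -> size mu = m.+1 -> B l mu -> B k mu.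
  move=> + smu; elim: l => [|l IHl]; first by rewrite leqn0 => /eqP->.
  by rewrite leq_eqVlt => /predU1P[->//|/IHl IH /dec-/(_ smu)].
have [K stabK] : exists K, forall k mu, (K <= k)%N -> size mu = m ->
    slice (B k) k mu = slice (B K) K mu.
  apply: (IHm (fun k => slice (B k) k)) => [k|k mu smu]; first exact: down_slice.
  move=> h; apply: (slice_le (dB k) smu (leqnSn k)).
  by apply: dec => //=; rewrite smu.
have [L stabL] : exists L, forall a, (a < K)%N -> forall k mu, (L <= k)%N -> size mu = m ->
    slice (B k) a mu = slice (B L) a mu.
  elim: (K) => [|N [L hL]]; first by exists 0%N.
  have [M hM] : exists M, forall k mu, (M <= k)%N -> size mu = m ->
      slice (B k) N mu = slice (B M) N mu.
    apply: (IHm (fun k => slice (B k) N)) => [k|k mu smu]; first exact: down_slice.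
    by apply: dec; rewrite /= smu.
  exists (maxn L M) => a; rewrite ltnS leq_eqVlt => /predU1P[->|aN] k mu;
    rewrite geq_max => /andP[Lk Mk] smu.
    by rewrite hM // [RHS]hM ?leq_maxr.
  by rewrite hL // [RHS]hL ?leq_maxl.
exists (maxn K L) => k [//|a mu]; rewrite geq_max => /andP[Kk Lk] /= [smu].
have [aK|Ka] := ltnP a K.
  by rewrite -!/(slice _ a mu) stabL // [RHS]stabL ?leq_maxr.
(* By monotonicity, membership of (a, mu) in B l is squeezed between the diagonal
   slices at K and at max l a, which agree. *)
have diag l : (K <= l)%N -> B l (a :: mu) = B K (K :: mu).
  move=> Kl; apply/idP/idP => h.
    by apply: (decl K l) => //=; rewrite ?smu //; apply: (slice_le (dB l) smu Ka).
  have KM : (K <= maxn l a)%N by rewrite leq_max Kl.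
  apply: (decl l (maxn l a)); rewrite ?leq_maxl //= ?smu //.
  apply: (slice_le (dB _) smu (leq_maxr l a)).
  by have := stabK _ mu KM smu; rewrite /slice => ->.
by rewrite !diag // leq_maxl.
Qed.

End DownSets.

Section MonomialEnumeration.
Implicit Types (es mu : seq nat).

Fixpoint wdeg es mu : nat :=
  match es, mu with
  | e :: es', a :: mu' => (e * a + wdeg es' mu')%N
  | _, _ => 0%N
  end.

Fixpoint monomials es (d : nat) : seq (seq nat) :=
  if es is e :: es' then
    [seq a :: mu | a <- [seq a <- iota 0 d.+1 | (e * a <= d)%N],
                   mu <- monomials es' (d - e * a)]
  else if d == 0%N then [:: [::]] else [::].

Arguments monomials : simpl never.

Lemma monomials_rec e es d : monomials (e :: es) d =
  [seq a :: mu | a <- [seq a <- iota 0 d.+1 | (e * a <= d)%N],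
                 mu <- monomials es (d - e * a)].
Proof. by []. Qed.

Lemma mem_monomials es d mu : all (leq 1) es ->
  (mu \in monomials es d) = (size mu == size es) && (wdeg es mu == d).
Proof.
elim: es d mu => [|e es IHes] d mu; first by move=> _; case: d mu => [|d] [|a mu].
move=> /= /andP[e0 es0]; rewrite monomials_rec; apply/allpairsPdep/andP => [[a [nu [+ + ->]]]|[smu dmu]].
  rewrite mem_filter IHes // => /andP[ead _] /andP[/eqP snu /eqP dnu].
  by rewrite /= snu dnu subnKC.
case: mu smu dmu => [//|a nu]; rewrite [size _]/= [wdeg _ _]/= eqSS => snu /eqP dnu.
have ead : (e * a <= d)%N by rewrite -dnu leq_addr.
exists a, nu; split; [|by rewrite IHes // snu -dnu addKn eqxx|by []].
rewrite mem_filter ead mem_iota add0n ltnS /=.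
by apply: leq_trans ead; rewrite leq_pmull.
Qed.

Lemma uniq_monomials es d : uniq (monomials es d).
Proof.
elim: es d => [|e es IHes] d; first by rewrite /monomials; case: eqP.
rewrite monomials_rec; apply: allpairs_uniq_dep => [|a _|[a mu] [b nu] _ _ /= [-> ->]] //.
by rewrite filter_uniq ?iota_uniq.
Qed.

Definition bump_head mu := if mu is a :: mu' then a.+1 :: mu' else mu.

Lemma monomials_cons e es d : all (leq 1) (e :: es) ->
  perm_eq (monomials (e :: es) d)
    ([seq 0%N :: mu | mu <- monomials es d] ++
     (if (e <= d)%N then [seq bump_head mu | mu <- monomials (e :: es) (d - e)] else [::])).
Proof.
move=> pos; have /= /andP[e0 es0] := pos.
apply: uniq_perm; first exact: uniq_monomials.
  rewrite cat_uniq map_inj_uniq ?uniq_monomials => [|? ? [] //]; apply/and3P; split=> //.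
    apply/hasPn => mu; case: ifP => // _ /mapP[[|a nu]]; rewrite mem_monomials //= => _ ->.
    by apply/mapP => -[? _ []].
  case: ifP => // _; rewrite map_inj_in_uniq ?uniq_monomials //.
  by move=> [|a mu] [|b nu]; rewrite !mem_monomials //= => _ _ [-> ->].
move=> mu; rewrite mem_monomials // mem_cat; apply/andP/orP.
  case: mu => [|[|a] mu] [//= /eqP[smu] /eqP dmu].
    left; apply/mapP; exists mu => //; rewrite mem_monomials // smu eqxx /=.
    by rewrite -dmu muln0.
  have ed : (e <= d)%N by rewrite -dmu mulnS -addnA leq_addr.
  right; rewrite ed; apply/mapP; exists (a :: mu) => //.
  by rewrite mem_monomials //= smu eqxx -dmu mulnS -addnA addKn /=.
case=> [/mapP[nu]|].
  by rewrite mem_monomials // => /andP[/eqP snu /eqP dnu] -> /=; rewrite snu dnu muln0.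
case: ifP => // ed /mapP[[|a nu]]; rewrite mem_monomials //= => /andP[/eqP[snu] /eqP dnu] -> /=.
by rewrite snu mulnS -addnA dnu subnKC.
Qed.

Variable R : comNzRingType.
Implicit Types (ws : seq (R * nat)) (B : pred (seq nat)).

Fixpoint mon_weight (ws : seq (R * nat)) mu : R :=
  match ws, mu with
  | w :: ws', a :: mu' => w.1 ^+ a * mon_weight ws' mu'
  | _, _ => 1
  end.

Definition gen_fun ws B (d : nat) : R :=
  \sum_(mu <- monomials (map snd ws) d | B mu) mon_weight ws mu.

Lemma eq_gen_fun ws B B' : all (leq 1) (map snd ws) ->
  (forall mu, size mu = size ws -> B mu = B' mu) -> gen_fun ws B =1 gen_fun ws B'.
Proof.
move=> pos BB' d; rewrite /gen_fun big_seq_cond [RHS]big_seq_cond.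
apply: eq_bigl => mu; rewrite mem_monomials // size_map.
by case: eqP => //= /BB' ->.
Qed.

Lemma gen_fun_cons w ws B d : all (leq 1) (map snd (w :: ws)) ->
  gen_fun (w :: ws) B d =
  gen_fun ws (slice B 0) d + smulp (gen_fun (w :: ws) (shift B)) (w.1 *: 'X^(w.2)) d.
Proof.
move=> pos; rewrite smulp_monX {1}/gen_fun /=.
rewrite (perm_big _ (monomials_cons d pos)) /= big_cat big_map /=.
congr (_ + _).
  by apply: eq_bigr => mu _; rewrite expr0 mul1r.
case: ifP => _; last by rewrite big_nil.
rewrite big_map mulr_sumr big_seq_cond [RHS]big_seq_cond.
apply: eq_big => [[|a mu]|[|a mu]]; rewrite mem_monomials //=.
by move=> _; rewrite exprS mulrA.
Qed.

(** By the chain condition B is stable under shifting after finitely many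
    shifts.  The relation gf(B) = gf(slice 0) + w q^e gf(shift B) reduces to that
    case, in which it reads (1 - w q^e) gf(B) = gf(slice 0), with one variable
    less on the right. *)
Lemma gen_fun_rational ws B : all (leq 1) (map snd ws) ->
    down_closed (size ws) B ->
  exists P : {poly R}, forall d,
    smulp (gen_fun ws B) (\prod_(w <- ws) (1 - w.1 *: 'X^(w.2))) d = P`_d.
Proof.
elim: ws B => [|w ws IHws] B pos dB.
  exists (if B [::] then 1 else 0) => d; rewrite big_nil smulp1 /gen_fun /= /monomials.
  case: d => [|d] /=; rewrite ?big_nil; last by case: (B _); rewrite ?coef1 ?coef0.
  by rewrite big_cons big_nil; case: (B _); rewrite ?coef1 ?coef0 ?addr0.
have /= /andP[e0 pos'] := pos.
have [A stab] : exists A, forall k mu, (A <= k)%N -> size mu = size ws ->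
    slice B k mu = slice B A mu.
  apply: down_sets_dcc => [k|k mu smu]; first exact: down_slice.
  exact: (slice_le dB smu).
rewrite big_cons; set D := \prod_(j <- ws) _; set u := w.1 *: _.
elim: A B dB stab => [|A IHA] B dB stab.
  have [P0 hP0] := IHws (slice B 0) pos' (down_slice dB).
  exists P0 => d; rewrite -hP0 -smulpA; apply: eq_smulp => {}d.
  rewrite smulpBr smulp1 gen_fun_cons // -/u.
  rewrite (@eq_smulp _ (gen_fun (w :: ws) (shift B)) (gen_fun (w :: ws) B)) ?addrK //.
  apply: eq_gen_fun => // -[//|a mu] /= [smu].
  by rewrite -!/(slice B _ mu) stab // [RHS]stab.
have [P0 hP0] := IHws (slice B 0) pos' (down_slice dB).
have [|P1 hP1] := IHA (shift B) (down_shift dB).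
  by move=> k mu Ak smu; apply: (stab k.+1).
exists (P0 * (1 - u) + P1 * u) => d.
rewrite (eq_smulp _ (fun d => gen_fun_cons B d pos)) smulpDl coefD; congr (_ + _).
  by rewrite mulrC -smulpA (eq_smulp _ hP0) smulp_poly.
by rewrite smulpA mulrC -smulpA (eq_smulp _ hP1) smulp_poly.
Qed.

End MonomialEnumeration.

(** * Spans, bases and traces *)

Section Span.
Variables (K : fieldType) (Z : lmodType K).
Implicit Types (S T U : Z -> Prop) (z v : Z).

Inductive span S : Z -> Prop :=
| span0 : span S 0
| span_cons c v z : S v -> span S z -> span S (c *: v + z).

Lemma span_in S v : S v -> span S v.
Proof. by move=> Sv; rewrite -[v]scale1r -[_ *: _]addr0; apply: span_cons => //; apply: span0. Qed.

Lemma spanD S z z' : span S z -> span S z' -> span S (z + z').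
Proof.
move=> + h'; elim=> [|c v y Sv _ IH]; first by rewrite add0r.
by rewrite -addrA; apply: span_cons.
Qed.

Lemma spanZ S c z : span S z -> span S (c *: z).
Proof.
elim=> [|b v y Sv _ IH]; first by rewrite scaler0; apply: span0.
by rewrite scalerDr scalerA; apply: span_cons.
Qed.

Lemma span_sum S (I : Type) (r : seq I) (P : pred I) (F : I -> Z) :
  (forall i, P i -> span S (F i)) -> span S (\sum_(i <- r | P i) F i).
Proof. by move=> h; apply: big_ind => //; [apply: span0 | apply: spanD]. Qed.

Lemma span_map (f : Z -> Z) S T : linear f -> (forall v, S v -> span T (f v)) ->
  forall z, span S z -> span T (f z).
Proof.
move=> lf ST z; elim=> [|c v y Sv _ IH].
  have -> : f 0 = 0 by have := lf (-1) 0 0; rewrite scaler0 addr0 scaleN1r addNr.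
  exact: span0.
by rewrite lf; apply: spanD => //; apply: spanZ; apply: ST.
Qed.

Lemma span_sub S T : (forall v, S v -> span T v) -> forall z, span S z -> span T z.
Proof. by move=> ST z; apply: (@span_map id). Qed.

Lemma basis_subspace m (b : 'I_m -> Z) U : is_basis U b ->
  U 0 /\ forall c z z', U z -> U z' -> U (c *: z + z').
Proof.
move=> [Ub _]; split=> [|c z z' /Ub[a ->] /Ub[a' ->]]; apply/Ub.
  by exists (fun=> 0); rewrite big1 // => i _; rewrite scale0r.
exists (fun i => c * a i + a' i); rewrite scaler_sumr -big_split.
by apply: eq_bigr => i _; rewrite scalerDl scalerA.
Qed.

Lemma fin_dim_span U S z : fin_dim U -> (forall v, S v -> U v) -> span S z -> U z.
Proof.
move=> [m [b /basis_subspace[U0 Ulin]]] SU.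
by elim=> [//|c v y Sv _ Uy]; apply: Ulin => //; apply: SU.
Qed.

Lemma linear_comb (f : Z -> Z) (I : Type) (s : seq I) (c : I -> K) (v : I -> Z) :
  linear f -> f (\sum_(i <- s) c i *: v i) = \sum_(i <- s) c i *: f (v i).
Proof.
move=> lf; pose g : {linear Z -> Z} := HB.pack f (GRing.isLinear.Build _ _ _ _ f lf).
by rewrite -[f]/(g : Z -> Z) linear_sum; apply: eq_bigr => i _; rewrite linearZ.
Qed.

Lemma comb_of_combs (I J : finType) (c : J -> K) (D : J -> I -> K) (v : I -> Z) :
  \sum_j c j *: (\sum_i D j i *: v i) = \sum_i (\sum_j D j i * c j) *: v i.
Proof.
under eq_bigr do rewrite scaler_sumr; rewrite exchange_big; apply: eq_bigr => i _.
by rewrite scaler_suml; apply: eq_bigr => j _; rewrite scalerA mulrC.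
Qed.

Lemma delta_comb m (v : 'I_m -> Z) j : \sum_i (i == j)%:R *: v i = v j.
Proof.
by rewrite (bigD1 j) //= eqxx scale1r big1 ?addr0 // => i /negPf ->; rewrite scale0r.
Qed.

Lemma basis_mem m (b : 'I_m -> Z) U i : is_basis U b -> U (b i).
Proof. by move=> [Ub _]; apply/Ub; exists (fun j => (j == i)%:R); rewrite delta_comb. Qed.

Lemma basis_coord m (b : 'I_m -> Z) U c c' : is_basis U b ->
  \sum_i c i *: b i = \sum_i c' i *: b i -> c =1 c'.
Proof.
move=> [_ ind] E i; apply/eqP; rewrite -subr_eq0; apply/eqP.
apply: (ind (fun i => c i - c' i)).
rewrite (eq_bigr (fun i => c i *: b i - c' i *: b i)) => [|j _].
  by rewrite sumrB E subrr.
by rewrite scalerBl.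
Qed.

(** Transition matrices P and Q between the two bases are inverse to each other;
    the two matrices of T are M and Q M P, and tr (Q M P) = tr (M P Q). *)
Lemma has_trace_unique U (T : Z -> Z) t t' : linear T -> has_trace U T t -> has_trace U T t' -> t = t'.
Proof.
move=> linT [m [b [M [bas TM <-]]]] [m' [b' [M' [bas' TM' <-]]]].
have /choice[P hP] : forall j, exists c : 'I_m -> K, b' j = \sum_i c i *: b i.
  by move=> j; apply/(proj1 bas)/(basis_mem j bas').
have /choice[Q hQ] : forall j, exists c : 'I_m' -> K, b j = \sum_i c i *: b' i.
  by move=> j; apply/(proj1 bas')/(basis_mem j bas).
pose mP := \matrix_(i, j) P j i; pose mQ := \matrix_(i, j) Q j i.
have QP : mQ *m mP = 1%:M.
  apply/matrixP => i j; rewrite !mxE; have := esym (delta_comb b' j).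
  rewrite {1}hP (eq_bigr (fun i => P j i *: \sum_l Q i l *: b' l)) => [|k _]; last by rewrite -hQ.
  rewrite comb_of_combs => /(basis_coord bas') /(_ i) <-.
  by apply: eq_bigr => k _; rewrite !mxE.
have PQ : mP *m mQ = 1%:M.
  apply/matrixP => i j; rewrite !mxE; have := esym (delta_comb b j).
  rewrite {1}hQ (eq_bigr (fun i => Q j i *: \sum_l P i l *: b l)) => [|k _]; last by rewrite -hP.
  rewrite comb_of_combs => /(basis_coord bas) /(_ i) <-.
  by apply: eq_bigr => k _; rewrite !mxE.
have MP : M *m mP = mP *m M'.
  apply/matrixP => i j; have := TM' j.
  rewrite hP linear_comb // (eq_bigr (fun i => P j i *: \sum_l M l i *: b l)) => [|k _]; last by rewrite -TM.
  rewrite comb_of_combs (eq_bigr (fun k => M' k j *: \sum_l P k l *: b l)) => [|k _]; last by rewrite -hP.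
  rewrite comb_of_combs => /(basis_coord bas) /(_ i) E.
  rewrite !mxE (eq_bigr (fun l => M i l * P j l)) => [|l _]; last by rewrite mxE.
  by rewrite E; apply: eq_bigr => l _; rewrite mxE.
by rewrite -[M']mul1mx -QP -mulmxA -MP mulmxA mxtrace_mulC mulmxA PQ mul1mx.
Qed.

Section ListBasis.
Variables (T : eqType) (G : T -> Z).
Implicit Types (L M : seq T).

Definition vectors L : Z -> Prop := fun v => exists2 x, x \in L & v = G x.

Lemma span_seqP L z : uniq L ->
  span (vectors L) z <-> exists c : T -> K, z = \sum_(x <- L) c x *: G x.
Proof.
move=> uL; split=> [|[c ->]]; last first.
  by rewrite big_seq; apply: span_sum => x xL; apply/spanZ/span_in; exists x.
elim=> [|c v y [x xL ->] _ [d ->]].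
  by exists (fun=> 0); rewrite big1 // => x _; rewrite scale0r.
exists (fun w => (if w == x then c else 0) + d w).
rewrite [RHS](eq_bigr (fun w => (if w == x then c else 0) *: G w + d w *: G w)).
  rewrite [RHS]big_split /= [X in _ = X + _](bigD1_seq x) //= eqxx.
  congr (_ + _); rewrite big1 ?addr0 // => w /negPf ->.
  by rewrite scale0r.
by move=> w _; rewrite scalerDl.
Qed.

Lemma seq_basis U M : uniq M ->
    (forall z, U z <-> exists c : T -> K, z = \sum_(x <- M) c x *: G x) ->
    (forall c : T -> K, \sum_(x <- M) c x *: G x = 0 -> forall x, x \in M -> c x = 0) ->
  is_basis U (fun i : 'I_(size M) => G (tnth (in_tuple M) i)).
Proof.
move=> uM UM ind.
have ext (c : 'I_(size M) -> K) : exists2 c' : T -> K,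
    forall i, c' (tnth (in_tuple M) i) = c i &
    \sum_i c i *: G (tnth (in_tuple M) i) = \sum_(x <- M) c' x *: G x.
  pose c' x := if insub (index x M) is Some i then c i else 0.
  have c'E i : c' (tnth (in_tuple M) i) = c i.
    by rewrite /c' (tnth_nth (tnth (in_tuple M) i)) index_uniq ?valK.
  exists c' => //; rewrite [RHS]big_tnth.
  by apply: eq_bigr => i _; rewrite c'E.
split=> [z|c].
  split=> [/UM[c ->]|[c ->]]; last by apply/UM; have [c' _ ->] := ext c; exists c'.
  by exists (fun i => c (tnth (in_tuple M) i)); rewrite big_tnth.
by have [c' c'E ->] := ext c; move=> /ind h i; rewrite -c'E h // mem_tnth.
Qed.

Lemma seq_basis_trace U M (A : Z -> Z) (chi : T -> K) : uniq M ->
    is_basis U (fun i : 'I_(size M) => G (tnth (in_tuple M) i)) ->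
    (forall x, x \in M -> A (G x) = chi x *: G x) ->
  has_trace U A (\sum_(x <- M) chi x).
Proof.
move=> uM bas eig; exists (size M), (fun i => G (tnth (in_tuple M) i)).
exists (diag_mx (\row_i chi (tnth (in_tuple M) i))); split=> // [j|].
  rewrite eig ?mem_tnth // (bigD1 j) //= !mxE eqxx mulr1n big1 ?addr0 // => i /negPf ij.
  by rewrite !mxE ij mulr0n scale0r.
by rewrite mxtrace_diag [RHS]big_tnth; apply: eq_bigr => i _; rewrite mxE.
Qed.

(** In a linear relation between standard vectors, the largest one with a
    nonzero coefficient would be a combination of smaller ones; and by induction
    from the smallest vector on, every vector is a combination of standard
    ones. *)
Lemma greedy_basis (lt : rel T) (std : pred T) L :
    irreflexive lt -> transitive lt -> uniq L -> pairwise (fun x y => lt y x) L ->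
    (forall x, x \in L ->
       std x <-> ~ span (vectors [seq y <- L | lt y x]) (G x)) ->
  is_basis (span (vectors L))
    (fun i : 'I_(size [seq x <- L | std x]) => G (tnth (in_tuple [seq x <- L | std x]) i)).
Proof.
move=> irr tr uL pL stdP.
have uM : uniq [seq x <- L | std x] by rewrite filter_uniq.
have main : (forall z, span (vectors L) z -> span (vectors [seq x <- L | std x]) z) /\
    (forall c : T -> K, \sum_(x <- [seq x <- L | std x]) c x *: G x = 0 ->
       forall x, x \in [seq x <- L | std x] -> c x = 0).
  elim: L uL pL stdP {uM} => [|x L IHL]; first by move=> *; split.
  rewrite cons_uniq pairwise_cons => /andP[xL uL] /andP[/allP ltx pL] stdP.
  have below y : y \in x :: L -> [seq w <- x :: L | lt w y] = [seq w <- L | lt w y].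
    rewrite inE => /predU1P[->|/ltx yx] /=; first by rewrite irr.
    by case: ifP => // xy; have := tr _ _ _ yx xy; rewrite irr.
  have belowx : [seq w <- L | lt w x] = L.
    by apply/all_filterP/allP => w /ltx.
  have [|spL indL] := IHL uL pL.
    by move=> y yL; rewrite stdP ?inE ?yL ?orbT // below // inE yL orbT.
  have stdx : std x <-> ~ span (vectors L) (G x).
    by rewrite stdP ?inE ?eqxx // below ?inE ?eqxx // belowx.
  have wid (M M' : seq T) : {subset M <= M'} -> forall z, span (vectors M) z -> span (vectors M') z.
    by move=> MM'; apply: span_sub => v [y yM ->]; apply: span_in; exists y => //; apply: MM'.
  rewrite [[seq y <- x :: L | std y]]/=; case: ifP => sx; last first.
    split=> //; apply: span_sub => v [y + ->]; rewrite inE => /predU1P[->|yL].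
      apply: spL; apply: contrapT => nsp; by move/stdx: nsp; rewrite sx.
    by apply: spL; apply: span_in; exists y.
  split.
    apply: span_sub => v [y + ->]; rewrite inE => /predU1P[->|yL].
      by apply: span_in; exists x; rewrite ?inE ?eqxx.
    apply: (wid [seq w <- L | std w]) => [w wL|]; first by rewrite inE wL orbT.
    by apply: spL; apply: span_in; exists y.
  move=> c; rewrite big_cons => E.
  have cx : c x = 0.
    apply/eqP/negP => /negP cx0; move/stdx: sx; apply.
    have -> : G x = (- (c x)^-1) *: \sum_(w <- [seq w <- L | std w]) c w *: G w.
      apply: (scalerI cx0); rewrite scalerA mulrN mulfV // scaleN1r.
      by apply/eqP; rewrite -addr_eq0 E.
    apply: spanZ; rewrite big_seq; apply: span_sum => w; rewrite mem_filter => /andP[_ wL].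
    by apply/spanZ/span_in; exists w.
  move: E; rewrite cx scale0r add0r => /indL h y; rewrite inE => /predU1P[->//|].
  exact: h.
have [sp ind] := main; apply: seq_basis => // z; rewrite -span_seqP //; split; first exact: sp.
apply: span_sub => v [x + ->]; rewrite mem_filter => /andP[_ xL].
by apply: span_in; exists x.
Qed.

End ListBasis.

End Span.

(** * Homogeneous components *)

Section Homogeneous.
Variables (K : fieldType) (Z : lmodType K) (comp : nat -> Z -> Prop).
Hypotheses (fdim : forall d, fin_dim (comp d)) (direct : direct_decomp comp).

(** Group a combination of homogeneous vectors by degree: by uniqueness of
    components, the groups of degree other than d add up to 0. *)
Lemma span_homogeneous (T : nat -> Z -> Prop) d z :
    (forall e v, T e v -> comp e v) -> comp d z ->
    span (fun v => exists e, T e v) z -> span (T d) z.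
Proof.
move=> Tcomp zd spz.
have [N [x [spx xN zE]]] : exists N (x : nat -> Z), [/\ forall e, span (T e) (x e),
    forall e, (N <= e)%N -> x e = 0 & z = \sum_(e < N) x e].
  elim: z / spz {zd} => [|c v y [e0 Tv] _ [N [x [spx xN ->]]]].
    by exists 0%N, (fun=> 0); split=> [e|//|]; [apply: span0 | rewrite big_ord0].
  exists (maxn N e0.+1), (fun e => (if e == e0 then c *: v else 0) + x e); split.
  - move=> e; apply: spanD => //; case: eqP => [->|_]; last exact: span0.
    exact/spanZ/span_in.
  - move=> e; rewrite geq_max => /andP[Ne e0e].
    by rewrite xN // gtn_eqF ?addr0.
  rewrite big_split /=; congr (_ + _).
    have e0N : (e0 < maxn N e0.+1)%N by rewrite leq_max ltnSn orbT.
    rewrite (bigD1 (Ordinal e0N)) //= eqxx big1 ?addr0 // => i.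
    by rewrite -val_eqE /= => /negPf ->.
  rewrite (big_ord_widen _ x (leq_maxl N e0.+1)) big_mkcond /=.
  by apply: eq_bigr => i _; case: ltnP => // /xN.
have [_ indep] := direct.
have subc e : comp e 0 /\ forall c u v, comp e u -> comp e v -> comp e (c *: u + v).
  by have [m [b /basis_subspace]] := fdim e.
suff -> : z = x d by [].
pose y e := x e - (if e == d then z else 0).
have yc e : comp e (y e).
  have [c0 clin] := subc e; rewrite /y -scaleN1r addrC; apply: clin.
    by case: eqP => [->|].
  exact: (fin_dim_span (fdim e) (Tcomp e)).
have dN : (d < maxn N d.+1)%N by rewrite leq_max ltnSn orbT.
have /(indep _ _ yc)/(_ d dN) : \sum_(e < maxn N d.+1) y e = 0.
  have E1 : \sum_(e < maxn N d.+1) x e = z.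
    rewrite zE (big_ord_widen _ x (leq_maxl N d.+1)) [RHS]big_mkcond /=.
    by apply: eq_bigr => i _; case: ltnP => // /xN.
  have E2 : \sum_(e < maxn N d.+1) (if val e == d then z else 0) = z.
    rewrite (bigD1 (Ordinal dN)) //= eqxx big1 ?addr0 // => i.
    by rewrite -val_eqE /= => /negPf ->.
  by rewrite sumrB E1 E2 subrr.
by rewrite /y eqxx => /eqP; rewrite subr_eq0 => /eqP.
Qed.

End Homogeneous.

(** * Standard monomials of an equivariant module *)

Section LexOrder.
Implicit Types (s t u : seq nat).

Fixpoint lexlt s t : bool :=
  match s, t with
  | a :: s', b :: t' => (a < b)%N || ((a == b) && lexlt s' t')
  | [::], _ :: _ => true
  | _, _ => false
  end.

Lemma lexlt_irr : irreflexive lexlt.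
Proof. by elim=> //= a s ->; rewrite ltnn andbF. Qed.

Lemma lexlt_trans : transitive lexlt.
Proof.
elim=> [|b t IH] [|a s] [|c u] //= /orP[ab|/andP[/eqP-> st]] /orP[bc|/andP[/eqP bc tu]].
- by rewrite (ltn_trans ab bc).
- by rewrite -bc ab.
- by rewrite bc.
by rewrite bc eqxx (IH _ _ st tu) orbT.
Qed.

Lemma lexlt_total s t : s != t -> lexlt s t || lexlt t s.
Proof.
elim: s t => [|a s IH] [|b t] //=; rewrite eqseq_cons negb_and.
by case: ltngtP => //= _ /IH.
Qed.

Definition madd s t := [seq (p.1 + p.2)%N | p <- zip s t].

Lemma size_madd s t : size s = size t -> size (madd s t) = size t.
Proof. by move=> st; rewrite size_map size2_zip ?st. Qed.

Lemma lexlt_madd u s t : size s = size u -> size t = size u ->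
  lexlt s t -> lexlt (madd u s) (madd u t).
Proof.
elim: u s t => [|c u IH] [|a s] [|b t] //= [ss] [st].
by rewrite ltn_add2l eqn_add2l; case: ltngtP => //= _; apply: IH.
Qed.

Lemma madd_sub s t : size s = size t -> all2 leq s t ->
  exists2 u, size u = size s & t = madd u s.
Proof.
elim: s t => [|a s IH] [|b t] //=; first by exists [::].
move=> [st] /andP[ab /(IH _ st)[u su ->]]; exists ((b - a)%N :: u); rewrite /= ?su //.
by rewrite /madd /= subnK.
Qed.

Lemma sort_decreasing (L : seq (seq nat)) : uniq L ->
  pairwise (fun x y => lexlt y x) (sort (fun x y => ~~ lexlt x y) L).
Proof.
move=> uL; set L' := sort _ L.
have uL' : uniq L' by rewrite sort_uniq.
have tot : total (fun x y => ~~ lexlt x y).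
  move=> x y; rewrite -negb_and; apply/negP => /andP[xy yx].
  by have := lexlt_trans xy yx; rewrite lexlt_irr.
have tr : transitive (fun x y => ~~ lexlt x y).
  move=> y x z xy yz; apply/negP => xz.
  have [E|/lexlt_total/orP[h|h]] := eqVneq x y; first by rewrite E (negPf yz) in xz.
    by rewrite h in xy.
  by rewrite (lexlt_trans h xz) in yz.
have := sort_sorted tot L; rewrite (sorted_pairwise tr) -/L' => pL.
move: uL'; rewrite uniq_pairwise => uL'.
have : pairwise [rel x y | ~~ lexlt x y && (x != y)] L'.
  by rewrite pairwise_relI pL.
apply: sub_pairwise => x y /= /andP[xy /lexlt_total].
by rewrite (negPf xy).
Qed.

Lemma wdeg_madd es s t : size s = size es -> size t = size es ->
  wdeg es (madd s t) = (wdeg es s + wdeg es t)%N.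
Proof.
elim: es s t => [|e es IH] [|a s] [|b t] //= [ss] [st].
by rewrite -[LHS]/(_ + wdeg es (madd s t))%N IH // mulnDr addnACA.
Qed.

Lemma mon_weight_madd (R : comNzRingType) (ws : seq (R * nat)) s t :
  size s = size ws -> size t = size ws ->
  mon_weight ws (madd s t) = mon_weight ws s * mon_weight ws t.
Proof.
elim: ws s t => [|w ws IH] [|a s] [|b t] //=; rewrite ?mulr1 // => -[ss] [st].
by rewrite -[LHS]/(_ * mon_weight ws (madd s t)) IH // exprD mulrACA.
Qed.

End LexOrder.

Section StandardMonomials.
Variables (K : fieldType) (n : nat) (Z : lmodType K).
Hypothesis charK : [pchar K] =i pred0.
Variables (act : ('I_n -> K) -> Z -> Z) (comp : nat -> Z -> Prop).
Hypothesis act_linear : forall t, (forall i, t i != 0) -> linear (act t).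
Hypotheses (fdim : forall d, fin_dim (comp d)) (direct : direct_decomp comp).
Variables (m : nat) (smul : {mpoly K[m]} -> Z -> Z).
Hypothesis modS : sym_module smul.

(* Each entry of D is an operator on Z with its weight and degree, each entry of
   Y a generator with its weight and degree. *)
Variables (D : seq ({mpoly K[m]} * ('rV[int]_n * nat)))
          (Y : seq (Z * ('rV[int]_n * nat))).

Hypothesis D_pos : forall u, u \in D -> (0 < u.2.2)%N.
Hypothesis D_comp : forall u d z, u \in D -> comp d z -> comp (u.2.2 + d)%N (smul u.1 z).
Hypothesis D_act : forall u t z, u \in D -> (forall i, t i != 0) ->
  act t (smul u.1 z) = zpow t u.2.1 *: smul u.1 (act t z).
Hypothesis Y_comp : forall y, y \in Y -> comp y.2.2 y.1.
Hypothesis Y_act : forall y t, y \in Y -> (forall i, t i != 0) ->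
  act t y.1 = zpow t y.2.1 *: y.1.

Let es := [seq u.2.2 | u <- D].
Let us := [seq (u.1, u.2.2) | u <- D].
Let ws := [seq (tmon u.2.1, u.2.2) | u <- D].
Let gen j := nth (0, (0, 0%N)) Y j.

(** The list j :: mu stands for the product of the monomial mu in the operators
    with the j-th generator. *)
Definition mon_vec (x : seq nat) : Z :=
  if x is j :: mu then smul (mon_weight us mu) (gen j).1 else 0.
Definition mon_deg (x : seq nat) : nat :=
  if x is j :: mu then ((gen j).2.2 + wdeg es mu)%N else 0%N.
Definition mon_char (x : seq nat) : laurent n :=
  if x is j :: mu then tmon (gen j).2.1 * mon_weight ws mu else 0.

Definition mons_of_deg d : seq (seq nat) :=
  [seq j :: mu | j <- [seq j <- iota 0 (size Y) | ((gen j).2.2 <= d)%N],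
                 mu <- monomials es (d - (gen j).2.2)].

Hypothesis spanning : forall z,
  span (fun v => exists j mu,
    [/\ (j < size Y)%N, size mu = size D & v = mon_vec (j :: mu)]) z.

Let es_pos : all (leq 1) es.
Proof. by apply/allP => _ /mapP[u uD ->]; apply: D_pos. Qed.

Let genY j : (j < size Y)%N -> gen j \in Y.
Proof. exact: mem_nth. Qed.

Lemma mem_mons_of_deg d j mu : (j :: mu \in mons_of_deg d) =
  [&& (j < size Y)%N, size mu == size D & mon_deg (j :: mu) == d].
Proof.
apply/allpairsPdep/and3P => [[k [nu [+ + [-> ->]]]]|[jY smu dmu]].
  rewrite mem_filter mem_iota mem_monomials // size_map add0n => /andP[kd kY] /andP[-> /eqP E].
  by rewrite /= E subnKC.
exists j, mu; move: dmu => /= /eqP dmu.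
have jd : ((gen j).2.2 <= d)%N by rewrite -dmu leq_addr.
rewrite mem_filter jd mem_iota jY mem_monomials // size_map smu -dmu addKn eqxx.
by split.
Qed.

Lemma mons_of_degP d x : x \in mons_of_deg d -> exists j mu,
  [/\ x = j :: mu, (j < size Y)%N, size mu = size D & mon_deg x = d].
Proof.
case: x => [/allpairsPdep[j [mu []]]//|j mu].
by rewrite mem_mons_of_deg => /and3P[jY /eqP smu /eqP dmu]; exists j, mu.
Qed.

Lemma uniq_mons_of_deg d : uniq (mons_of_deg d).
Proof.
apply: allpairs_uniq_dep => [|j _|[j mu] [k nu] _ _ /= [-> ->]] //.
  by rewrite filter_uniq ?iota_uniq.
exact: uniq_monomials.
Qed.

Let smulZ p c z : smul p (c *: z) = c *: smul p z.
Proof. by case: modS => _ _ sM sC; rewrite -!sC -!sM mulrC. Qed.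

Let smul_linear p : linear (smul p).
Proof. by case: modS => _ sD _ _ c y z; rewrite sD smulZ. Qed.

(** Weights and degrees of commuting operators add up.  The induction is on the
    list of operators, whence the sublist E. *)
Lemma operator_monomial (E : seq ({mpoly K[m]} * ('rV[int]_n * nat))) mu d z t :
    {subset E <= D} -> size mu = size E -> (forall i, t i != 0) -> comp d z ->
  comp (wdeg [seq u.2.2 | u <- E] mu + d)%N
    (smul (mon_weight [seq (u.1, u.2.2) | u <- E] mu) z) /\
  act t (smul (mon_weight [seq (u.1, u.2.2) | u <- E] mu) z) =
    leval t (mon_weight [seq (tmon u.2.1, u.2.2) | u <- E] mu) *:
      smul (mon_weight [seq (u.1, u.2.2) | u <- E] mu) (act t z).
Proof.
case: modS => _ _ sM sC => + + t0 zd.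
have s1 y : smul 1 y = y by rewrite -[1]mpolyC1 sC scale1r.
elim: E mu => [|u E IH] [|a mu] //= sub smu.
  by rewrite s1 -tmon0 leval_tmon zpow0 scale1r.
case: smu => smu; have [|IH1 IH2] := IH mu _ smu.
  by move=> v vE; apply: sub; rewrite inE vE orbT.
have uD : u \in D by apply: sub; rewrite inE eqxx.
rewrite levalM // tmonX leval_tmon zpow_muln //.
elim: a => [|a [IHa1 IHa2]].
  by rewrite muln0 add0n !expr0 !mul1r.
split.
  rewrite exprS -mulrA sM mulnS -!addnA; apply: D_comp => //.
  by rewrite addnA.
by rewrite exprS -mulrA sM D_act // IHa2 smulZ scalerA exprS -mulrA -sM mulrA -exprS.
Qed.

Lemma mon_vec_comp d x : x \in mons_of_deg d -> comp d (mon_vec x).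
Proof.
move=> /mons_of_degP[j [mu [-> jY smu <-]]] /=; rewrite addnC.
have t0 (i : 'I_n) : (fun=> 1 : K) i != 0 by rewrite oner_neq0.
by case: (operator_monomial (fun _ h => h) smu t0 (Y_comp (genY jY))).
Qed.

Lemma mon_vec_act d x t : x \in mons_of_deg d -> (forall i, t i != 0) ->
  act t (mon_vec x) = leval t (mon_char x) *: mon_vec x.
Proof.
move=> /mons_of_degP[j [mu [-> jY smu _]]] t0 /=.
case: (operator_monomial (fun _ h => h) smu t0 (Y_comp (genY jY))) => _ ->.
by rewrite Y_act ?genY // smulZ scalerA levalM // leval_tmon mulrC.
Qed.

Lemma comp_span_mons d z : comp d z <-> span (vectors mon_vec (mons_of_deg d)) z.
Proof.
have vc e v : vectors mon_vec (mons_of_deg e) v -> comp e v.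
  by move=> [x xd ->]; apply: mon_vec_comp.
split; last exact: fin_dim_span (fdim d) (vc d).
move=> zd; apply: (span_homogeneous fdim direct vc zd).
apply: span_sub (spanning z) => v [j [mu [jY smu ->]]].
apply: span_in; exists (mon_deg (j :: mu)), (j :: mu) => //.
by rewrite mem_mons_of_deg jY smu !eqxx.
Qed.

Definition standard (x : seq nat) : bool :=
  `[< ~ span (vectors mon_vec [seq y <- mons_of_deg (mon_deg x) | lexlt y x]) (mon_vec x) >].

(** The standard monomials of degree d are a basis of the d-th component, and
    each of them is an eigenvector of the torus. *)
Lemma standard_trace d t : (forall i, t i != 0) ->
  has_trace (comp d) (act t) (\sum_(x <- mons_of_deg d | standard x) leval t (mon_char x)).
Proof.
move=> t0; set L := sort (fun x y => ~~ lexlt x y) (mons_of_deg d).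
have LE x : (x \in L) = (x \in mons_of_deg d) by rewrite mem_sort.
have uL : uniq L by rewrite sort_uniq uniq_mons_of_deg.
have vecE (M M' : seq (seq nat)) z : M =i M' ->
    span (vectors mon_vec M) z -> span (vectors mon_vec M') z.
  by move=> MM; apply: span_sub => v [x xM ->]; apply: span_in; exists x; rewrite -?MM.
have bas := @greedy_basis _ _ _ mon_vec lexlt standard L lexlt_irr lexlt_trans uL
  (sort_decreasing (uniq_mons_of_deg d)).
have pE : perm_eq (mons_of_deg d) L by rewrite perm_sym perm_sort.
rewrite (perm_big _ pE) /= -big_filter.
apply: (@seq_basis_trace _ _ _ mon_vec); first by rewrite filter_uniq.
  suff [sp ind] : is_basis (span (vectors mon_vec L))
      (fun i : 'I_(size [seq x <- L | standard x]) =>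
        mon_vec (tnth (in_tuple [seq x <- L | standard x]) i)).
    split=> // z; rewrite comp_span_mons -sp.
    by split; apply: vecE => x; rewrite LE.
  apply: bas => x; rewrite LE => /mons_of_degP[j [mu [_ _ _ xd]]].
  split=> [/asboolP nsp /vecE sp|nsp]; [apply: nsp|apply/asboolP => /vecE sp; apply: nsp];
    by apply: sp => y; rewrite !mem_filter LE xd.
by move=> x; rewrite mem_filter LE => /andP[_ xd]; apply: mon_vec_act xd t0.
Qed.

(** Multiplying a relation that expresses a monomial by smaller ones yields such a
    relation for its multiples, so the standard monomials form an order ideal. *)
Lemma standard_down_closed j : (j < size Y)%N ->
  down_closed (size ws) (fun mu => standard (j :: mu)).
Proof.
move=> jY mu nu; rewrite size_map => smu snu le.
have [//|lam slam ->] := madd_sub _ le; first by rewrite smu.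
case: modS => _ _ sM _; rewrite smu in slam.
move=> /asboolP nsp; apply/asboolP => sp; apply: nsp.
have -> : mon_vec (j :: madd lam mu) = smul (mon_weight us lam) (mon_vec (j :: mu)).
  by rewrite /= mon_weight_madd ?size_map // sM.
apply: (span_map (smul_linear _) _ sp) => v [x].
rewrite mem_filter => /andP[xlt /mons_of_degP[k [kap [xE kY skap xd]]]] ->.
apply: span_in; exists (k :: madd lam kap); last first.
  by rewrite xE /= mon_weight_madd ?size_map // sM.
move: xlt xd; rewrite mem_filter mem_mons_of_deg kY size_madd ?slam ?skap // eqxx xE /=.
rewrite !wdeg_madd ?size_map // => /orP[->|/andP[/eqP-> lt]] /= xd.
  by rewrite addnCA xd addnCA.
by rewrite eqxx lexlt_madd ?slam ?skap ?smu // orbT addnCA xd addnCA eqxx.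
Qed.

(** The character is a sum over the generators of generating functions of order
    ideals, each shifted by the weight and degree of the generator. *)
Theorem equivariant_hilbert_series (chi : pseries n) :
    (forall d t, (forall i, t i != 0) -> has_trace (comp d) (act t) (leval t (chi d))) ->
  exists P : {poly laurent n},
    forall d, smulp chi (denom [seq u.2 | u <- D]) d = P`_d.
Proof.
move=> tr.
have chiE d : chi d = \sum_(x <- mons_of_deg d | standard x) mon_char x.
  apply: (leval_inj charK) => t t0; rewrite leval_sum.
  exact: has_trace_unique (act_linear t0) (tr d t t0) (standard_trace d t0).
have wsE : map snd ws = es by rewrite -map_comp.
have ws_pos : all (leq 1) (map snd ws) by rewrite wsE.
pose B j mu := standard (j :: mu).
have denE : denom [seq u.2 | u <- D] = \prod_(w <- ws) (1 - w.1 *: 'X^(w.2)) :> {poly laurent n}.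
  by rewrite /denom !big_map; apply: eq_bigr => u _; rewrite tmonE.
have /choice[P hP] : forall j : 'I_(size Y), exists P : {poly laurent n}, forall d,
    smulp (gen_fun ws (B j)) (denom [seq u.2 | u <- D]) d = P`_d.
  move=> j; rewrite denE; apply: gen_fun_rational => //.
  exact: standard_down_closed.
exists (\sum_(j < size Y) P j * (tmon (gen j).2.1 *: 'X^((gen j).2.2))) => d.
have chiE' : chi =1 fun d => \sum_(j < size Y)
    smulp (gen_fun ws (B j)) (tmon (gen j).2.1 *: 'X^((gen j).2.2)) d.
  move=> {}d; rewrite chiE /mons_of_deg big_mkcond big_allpairs_dep /= big_filter.
  rewrite -(big_mkord (fun j => true) (fun j =>
    smulp (gen_fun ws (B j)) (tmon (gen j).2.1 *: 'X^((gen j).2.2)) d)).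
  rewrite /index_iota subn0 big_mkcond; apply: eq_bigr => j _.
  rewrite smulp_monX; case: ifP => // _.
  rewrite /gen_fun wsE mulr_sumr [RHS]big_mkcond; apply: eq_bigr => mu _.
  by rewrite /B; case: ifP.
rewrite (eq_smulp _ chiE') coef_sum smulp_sum.
under eq_bigr => i _ do rewrite mulr_suml.
rewrite exchange_big; apply: eq_bigr => j _.
by rewrite -smulp_sum smulpA mulrC -smulpA (eq_smulp _ (hP j)) smulp_poly.
Qed.

End StandardMonomials.

(** * Weight vectors in rational representations *)

Section WeightDecomposition.
Variables (K : fieldType) (n : nat).
Hypothesis charK : [pchar K] =i pred0.

Definition torus (t : 'I_n -> K) : 'M[K]_n := diag_mx (\row_i t i).

Lemma det_torus t : \det (torus t) = \prod_i t i.
Proof. by rewrite det_diag; apply: eq_bigr => i _; rewrite mxE. Qed.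

Lemma torus_unit t : (forall i, t i != 0) -> torus t \in unitmx.
Proof. by move=> t0; rewrite unitmxE det_torus unitfE; apply/prodf_neq0. Qed.

Lemma torusM t t' : torus (fun i => t i * t' i) = torus t *m torus t'.
Proof.
rewrite /torus mul_diag_mx; apply/matrixP => i j; rewrite !mxE.
by case: eqP => _; rewrite ?mulr1n ?mulr0n ?mulr0.
Qed.

Lemma torus1 : torus (fun=> 1) = 1%:M.
Proof. by rewrite /torus -diag_const_mx; congr diag_mx; apply/rowP => i; rewrite !mxE. Qed.

Section LaurentFunctions.
Variable V : lmodType K.
Implicit Types (F : ('I_n -> K) -> V) (S : V -> Prop).

(** V-valued Laurent polynomial functions on the torus; keeping the coefficients
    in S is what makes weight components stay in an invariant subspace. *)
Definition laurent_fun S F : Prop :=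
  exists s : seq ('rV[int]_n * V), (forall x, x \in s -> S x.2) /\
    forall t, (forall i, t i != 0) -> F t = \sum_(x <- s) zpow t x.1 *: x.2.

Lemma laurent_funD S F F' : laurent_fun S F -> laurent_fun S F' ->
  laurent_fun S (fun t => F t + F' t).
Proof.
move=> [s [sS sE]] [s' [sS' sE']]; exists (s ++ s'); split=> [x|t t0].
  by rewrite mem_cat => /orP[/sS|/sS'].
by rewrite big_cat sE ?sE'.
Qed.

Lemma laurent_fun_sum S (I : Type) (r : seq I) (P : pred I) (F : I -> ('I_n -> K) -> V) :
  (forall i, P i -> laurent_fun S (F i)) ->
  laurent_fun S (fun t => \sum_(i <- r | P i) F i t).
Proof.
move=> h; elim: r => [|i r IH].
  by exists [::]; split=> // t t0; rewrite !big_nil.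
case Pi : (P i); last first.
  by have [s [sS sE]] := IH; exists s; split=> // t t0; rewrite big_cons Pi sE.
have [s [sS sE]] := laurent_funD (h _ Pi) IH; exists s; split=> // t t0.
by rewrite big_cons Pi sE.
Qed.

Lemma eq_laurent_fun S F F' : (forall t, (forall i, t i != 0) -> F t = F' t) ->
  laurent_fun S F -> laurent_fun S F'.
Proof. by move=> FF' [s [sS sE]]; exists s; split=> // t t0; rewrite -FF' // sE. Qed.

End LaurentFunctions.

Local Notation lfun := (@laurent_fun K^o (fun=> True)).

Lemma lfun_zpow c a : lfun (fun t => c * zpow t a).
Proof. by exists [:: (a, c)]; split=> // t _; rewrite big_cons big_nil addr0 [RHS]mulrC. Qed.

Lemma lfun_const c : lfun (fun=> c).
Proof. by apply: eq_laurent_fun (lfun_zpow c 0) => t _; rewrite zpow0 mulr1. Qed.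

Lemma lfunM (F F' : ('I_n -> K) -> K) : lfun F -> lfun F' -> lfun (fun t => F t * F' t).
Proof.
move=> [s [_ sE]] [s' [_ sE']].
apply: (@eq_laurent_fun _ _ (fun t => \sum_(x <- s) \sum_(y <- s') (x.2 * y.2) * zpow t (x.1 + y.1) : K^o)).
  move=> t t0; rewrite sE // sE' // mulr_suml; apply: eq_bigr => x _.
  by rewrite mulr_sumr; apply: eq_bigr => y _; rewrite zpowD // mulrC mulrACA.
by do 2!apply: laurent_fun_sum => ? _; apply: lfun_zpow.
Qed.

Lemma lfun_prod (I : Type) (r : seq I) (F : I -> ('I_n -> K) -> K) :
  (forall i, lfun (F i)) -> lfun (fun t => \prod_(i <- r) F i t).
Proof.
move=> h; elim: r => [|i r IH].
  by apply: eq_laurent_fun (lfun_const 1) => t _; rewrite big_nil.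
by apply: eq_laurent_fun (lfunM (h i) IH) => t _; rewrite big_cons.
Qed.

Lemma lfun_exp F k : lfun F -> lfun (fun t => F t ^+ k).
Proof.
move=> h; apply: eq_laurent_fun (lfun_prod (iota 0 k) (fun=> h)) => t _.
by rewrite big_const_seq count_predT size_iota iter_mulr mulr1.
Qed.

Lemma lfun_coord i : lfun (fun t => t i).
Proof.
apply: eq_laurent_fun (lfun_zpow 1 (\row_j (j == i)%:R)) => t _.
rewrite mul1r /zpow (bigD1 i) //= !mxE eqxx expr1z big1 ?mulr1 // => j /negPf ji.
by rewrite mxE ji expr0z.
Qed.

(** On the torus det is the product of the coordinates, a monomial, so dividing by
    its powers leaves Laurent polynomials. *)
Lemma lfun_regular (r : 'M[K]_n -> K) : regular_GL r -> lfun (fun t => r (torus t)).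
Proof.
move=> [p [k rE]].
apply: (@eq_laurent_fun _ _ (fun t => p.@[fun i => mxvec (torus t) 0 i] *
    zpow t (\row_i (- (k : int))) : K^o)) => [t t0|].
  rewrite rE ?torus_unit // det_torus; congr (_ * _); rewrite /zpow -prodrXl -prodfV.
  by apply: eq_bigr => i _; rewrite mxE exprnN.
apply: lfunM; last by apply: eq_laurent_fun (lfun_zpow 1 _) => t _; rewrite mul1r.
apply: (@eq_laurent_fun _ _ (fun t => \sum_(mu <- msupp p) p@_mu *
    \prod_i (mxvec (torus t) 0 i) ^+ mu i : K^o)) => [t _|]; first by rewrite mevalE.
apply: laurent_fun_sum => mu _; apply: lfunM; first exact: lfun_const.
apply: lfun_prod => i; apply: lfun_exp; case/mxvec_indexP: i => i j.
have [<-|/negPf ij] := eqVneq i j.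
  by apply: eq_laurent_fun (lfun_coord i) => t _; rewrite mxvecE !mxE eqxx.
by apply: eq_laurent_fun (lfun_const 0) => t _; rewrite mxvecE !mxE ij.
Qed.

Lemma morphism_GL_entry m (rho : 'M[K]_n -> 'M[K]_m) i j :
  morphism_GL rho -> regular_GL (fun g => rho g i j).
Proof.
move=> [_ h]; apply: (h (fun M => M i j)); exists 'X_(mxvec_index i j), 0%N => g _.
by rewrite mevalXU mxvecE expr0 divr1.
Qed.

Variables (Z : lmodType K) (act : 'M[K]_n -> Z -> Z).
Hypothesis rat : rational_rep act.

Lemma act_linear g : g \in unitmx -> linear (act g).
Proof. by case: rat => -[lin _ _] _ _; apply: lin. Qed.

Definition weight_vector (a : 'rV[int]_n) (v : Z) : Prop :=
  forall t, (forall i, t i != 0) -> act (torus t) v = zpow t a *: v.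

(** Write act (t) v as a Laurent polynomial in t with coefficients v_a.  Comparing
    the coefficients of t^a in act (t') (act (t) v) = act (t t') v shows that v_a
    has weight a, and t = 1 shows that v is the sum of the v_a. *)
Lemma weight_decomposition U v : fin_dim U -> GL_invariant act U -> U v ->
  exists s : seq ('rV[int]_n * Z),
    (forall x, x \in s -> U x.2 /\ weight_vector x.1 x.2) /\ v = \sum_(x <- s) x.2.
Proof.
move=> [m [b bas]] inv Uv.
have [U0 Ulin] := basis_subspace bas.
have [[lin act1 actM] _ /(_ _ _ _ bas inv)[rho rho_mor rhoE]] := rat.
have Ub i : U (b i) by apply: basis_mem bas.
have UZ c z : U z -> U (c *: z) by move=> Uz; rewrite -[c *: z]addr0; apply: Ulin.
have [x vE] := (proj1 (proj1 bas v)) Uv.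
have [s [sU sE]] : laurent_fun U (fun t => act (torus t) v).
  apply: (@eq_laurent_fun _ _ (fun t => \sum_j \sum_i (x j * rho (torus t) i j) *: b i)).
    move=> t t0; have tu := torus_unit t0.
    rewrite vE linear_comb; last exact: lin.
    apply: eq_bigr => j _; rewrite rhoE // scaler_sumr.
    by apply: eq_bigr => i _; rewrite scalerA.
  apply: laurent_fun_sum => j _; apply: laurent_fun_sum => i _.
  have [r [_ rE]] := lfunM (lfun_const (x j)) (lfun_regular (morphism_GL_entry i j rho_mor)).
  exists [seq (y.1, y.2 *: b i) | y <- r]; split=> [y /mapP[y' _ ->]|t t0]; first exact: UZ.
  by rewrite rE // scaler_suml big_map; apply: eq_bigr => y _; rewrite scalerA.
pose A := undup (map fst s); pose w a := \sum_(y <- s | y.1 == a) y.2.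
have actE t : (forall i, t i != 0) -> act (torus t) v = \sum_(a <- A) zpow t a *: w a.
  move=> t0; rewrite sE // (eq_bigr (fun a => \sum_(y <- s) if y.1 == a then zpow t y.1 *: y.2 else 0)).
    rewrite exchange_big big_seq [RHS]big_seq; apply: eq_bigr => y ys.
    rewrite (bigD1_seq y.1) ?undup_uniq ?mem_undup ?map_f //= eqxx.
    by rewrite big1 ?addr0 // => a; rewrite eq_sym => /negPf ->.
  move=> a _; rewrite scaler_sumr [LHS]big_mkcond; apply: eq_bigr => y _.
  by case: eqP => [->|].
have wU a : U (w a).
  rewrite /w big_seq_cond; apply: big_ind => // [y z Uy Uz|y /andP[/sU //]].
  by rewrite -[y]scale1r; apply: Ulin.
exists [seq (a, w a) | a <- A]; split; last first.
  rewrite big_map -[LHS]act1 -torus1 actE => [|i]; last exact: oner_neq0.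
  apply: eq_bigr => a _; have -> : zpow (fun=> 1) a = 1 :> K; last by rewrite scale1r.
  by rewrite /zpow big1 // => i _; rewrite exp1rz.
move=> y /mapP[a aA ->]; split=> //= t' t0'.
apply/eqP; rewrite -subr_eq0; apply/eqP.
apply: (zpow_independent charK (v := fun a => act (torus t') (w a) - zpow t' a *: w a) _ _ aA).
  exact: undup_uniq.
move=> t t0; have tt0 i : t' i * t i != 0 by rewrite mulf_neq0.
have := actE _ tt0; rewrite torusM actM ?torus_unit // actE //.
rewrite linear_comb; last exact: lin (torus_unit t0').
move=> /eqP; rewrite -subr_eq0 -sumrB => /eqP E.
rewrite -[RHS]E; apply: eq_bigr => c _.
by rewrite zpowM scalerBr scalerA [zpow t c * _]mulrC.
Qed.

End WeightDecomposition.

(** * Characters of modules in the class are rational *)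

Section CharactersAreRational.
Variables (K : fieldType) (n : nat).
Hypothesis charK : [pchar K] =i pred0.

(** Requiring k > 0 in every factor 1 - t^a q^k makes denominators have constant
    term 1, so that no product of them vanishes. *)
Definition rational (f : pseries n) : Prop :=
  exists (s : seq ('rV[int]_n * nat)) (P : {poly laurent n}),
    all (fun ak => 0 < ak.2)%N s /\ forall d, smulp f (denom s) d = P`_d.

Lemma rational_combination N (c : 'I_N -> int) (h : 'I_N -> pseries n) f :
  (forall i, rational (h i)) -> (forall d, f d = \sum_i h i d *~ c i) -> rational f.
Proof.
elim: N c h f => [|N IH] c h f rat fE.
  exists [::], 0; split=> // d; rewrite /denom big_nil smulp1 fE big_ord0 coef0 //.
pose g d := \sum_(i < N) h (lift ord0 i) d *~ c (lift ord0 i).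
have [s [P [s0 sP]]] := IH (fun i => c (lift ord0 i)) (fun i => h (lift ord0 i)) g
  (fun i => rat _) (fun d => erefl).
have [s' [P' [s0' sP']]] := rat ord0.
exists (s' ++ s), (P' *~ c ord0 * denom s + P * denom s').
split=> [|d]; first by rewrite all_cat s0'.
have fE' : f =1 (fun d => h ord0 d *~ c ord0 + g d) by move=> {}d; rewrite fE big_ord_recl.
rewrite (eq_smulp _ fE') smulpDl coefD denom_cat; congr (_ + _).
  rewrite -smulpA -smulp_poly; apply: eq_smulp => {}d.
  by rewrite smulpMzl sP' -[RHS]/(coefp d _) raddfMz.
by rewrite mulrC -smulpA (eq_smulp _ sP) smulp_poly.
Qed.

Section Module.
Variable Z : gradedRep K n.

Lemma comp_torus_eigen d v : @gr_comp _ _ Z d v ->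
  exists s : seq ('rV[int]_n * Z),
    (forall x, x \in s -> @gr_comp _ _ Z d x.2 /\ weight_vector (@gr_act _ _ Z) x.1 x.2) /\
    v = \sum_(x <- s) x.2.
Proof.
exact: (weight_decomposition charK (gr_rational Z) (@gr_fin_dim _ _ Z d) (@gr_invariant _ _ Z d)).
Qed.

Lemma below_torus_eigen N : exists Y : seq (Z * ('rV[int]_n * nat)),
  (forall y, y \in Y -> [/\ (y.2.2 < N)%N, @gr_comp _ _ Z y.2.2 y.1 &
     weight_vector (@gr_act _ _ Z) y.2.1 y.1]) /\
  (forall d z, (d < N)%N -> @gr_comp _ _ Z d z -> span (fun v => exists2 y, y \in Y & v = y.1) z).
Proof.
elim: N => [|N [Y [Yw Ysp]]]; first by exists [::].
have [m [b bas]] := @gr_fin_dim _ _ Z N.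
have bN i : @gr_comp _ _ Z N (b i) by apply: basis_mem bas.
have /choice[s hs] := fun i => comp_torus_eigen (bN i).
pose Y' := flatten [seq [seq (x.2, (x.1, N)) | x <- s i] | i <- enum 'I_m].
exists (Y' ++ Y); split=> [y|d z].
  rewrite mem_cat => /orP[/flattenP[_ /mapP[i _ ->] /mapP[x xs ->]]|/Yw[yN yc yw]].
    by have [xc xw] := proj1 (hs i) x xs.
  by split=> //; apply: ltnW.
have sub (A : seq (Z * ('rV[int]_n * nat))) : {subset A <= Y' ++ Y} -> forall v,
    span (fun v => exists2 y, y \in A & v = y.1) v ->
    span (fun v => exists2 y, y \in Y' ++ Y & v = y.1) v.
  by move=> AY; apply: span_sub => v [y yA ->]; apply: span_in; exists y => //; apply: AY.
rewrite ltnS leq_eqVlt => /predU1P[->|dN zd]; last first.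
  by apply: (sub Y) (Ysp _ _ dN zd) => y yY; rewrite mem_cat yY orbT.
move=> /(proj1 bas)[c ->]; apply: span_sum => i _; apply: spanZ.
rewrite (proj2 (hs i)) big_seq; apply: span_sum => x xs; apply: span_in.
exists (x.2, (x.1, N)) => //; rewrite mem_cat; apply/orP; left; apply/flattenP.
by exists [seq (x.2, (x.1, N)) | x <- s i]; apply: map_f; rewrite ?mem_enum.
Qed.

End Module.

Lemma linear_form_homog m (e : 'I_m -> nat) k (c : 'I_m -> K) :
  (forall i, c i != 0 -> e i = k) -> sym_homog e k (\sum_i c i *: 'X_i).
Proof.
move=> ce mu; rewrite mcoeff_msupp raddf_sum /= => nz.
have [i] : exists i, c i * ('X_i : {mpoly K[m]})@_mu != 0.
  apply/existsP; apply: contraNT nz => /existsPn h; apply/eqP/big1 => i _.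
  by rewrite mcoeffZ; apply/eqP; have := h i; rewrite negbK.
rewrite mulf_eq0 negb_or => /andP[/ce <-].
rewrite mcoeffX; have [<- _|_] := eqVneq U_(i)%MM mu; last by rewrite eqxx.
rewrite (bigD1 i) //= mnm1E eqxx muln1 big1 ?addn0 // => j ji.
by rewrite mnm1E eq_sym (negPf ji) muln0.
Qed.

Lemma sym_module_sum m (Z : lmodType K) (smul : {mpoly K[m]} -> Z -> Z)
    (I : Type) (r : seq I) (P : pred I) (F : I -> {mpoly K[m]}) z :
  sym_module smul ->
  smul (\sum_(i <- r | P i) F i) z = \sum_(i <- r | P i) smul (F i) z.
Proof.
move=> [sD _ _ sC]; apply: (big_morph (smul^~ z)) => [p q|]; first exact: sD.
by rewrite -mpolyC0 sC scale0r.
Qed.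

Lemma mon_weight0 (R : comNzRingType) (ws : seq (R * nat)) :
  mon_weight ws (nseq (size ws) 0%N) = 1.
Proof. by elim: ws => //= w ws ->; rewrite expr0 mul1r. Qed.

Lemma mon_weight1 (R : comNzRingType) (ws : seq (R * nat)) w : w \in ws ->
  exists2 mu, size mu = size ws & mon_weight ws mu = w.1.
Proof.
elim: ws => [//|w' ws IH]; rewrite inE => /predU1P[->|/IH[mu smu E]].
  by exists (1%N :: nseq (size ws) 0%N); rewrite /= ?size_nseq // mon_weight0 mulr1.
by exists (0%N :: mu); rewrite /= ?smu // E expr0 mul1r.
Qed.

(** The weight components of a homogeneous basis of W act on Z by commuting
    operators of definite weight and degree.  Those of degree 0 can be dropped:
    they preserve the finite dimensional space of vectors of degree < N, so if
    this space generates Z then it already does so under the others. *)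
Lemma class_char_rational (Z : gradedRep K n) (chi : pseries n) :
  classC Z -> graded_char Z chi -> rational chi.
Proof.
move=> [W [m [w [e [smul [bas [we [modS [smul_deg [fg equiv]]]]]]]]]] chiZ.
have [sD sDr sM sC] := modS.
have smulZ p c z : smul p (c *: z) = c *: smul p z by rewrite -!sC -!sM mulrC.
have smulZl p c z : smul (c *: p) z = c *: smul p z by rewrite -mul_mpolyC sM sC.
have smul_linear p : linear (smul p) by move=> c y z; rewrite sDr smulZ.
have /choice[cw cwE] : forall v : W, exists c : 'I_m -> K, v = \sum_i c i *: w i.
  by move=> v; apply/(proj1 bas).
pose lin (v : W) : {mpoly K[m]} := \sum_i cw v i *: 'X_i.
have cw_deg d v i : @gr_comp _ _ W d v -> cw v i != 0 -> e i = d.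
  move=> vd; have : span (vectors w [seq j <- enum 'I_m | e j == d]) v.
    apply: (@span_homogeneous _ _ _ (@gr_fin_dim _ _ W) (gr_direct W)
      (fun d => vectors w [seq j <- enum 'I_m | e j == d])) vd _.
      by move=> k _ [j + ->]; rewrite mem_filter => /andP[/eqP<- _].
    rewrite [v]cwE; apply: span_sum => j _; apply/spanZ/span_in.
    by exists (e j), j; rewrite // mem_filter eqxx mem_enum.
  have uE : uniq [seq j <- enum 'I_m | e j == d] by rewrite filter_uniq ?enum_uniq.
  move/(proj1 (span_seqP _ _ uE)) => [c].
  rewrite {1}[v]cwE big_filter big_enum_cond big_mkcond /= => vE.
  have /(basis_coord bas)/(_ i) -> : \sum_j cw v j *: w j =
      \sum_j (if e j == d then c j else 0) *: w j.
    rewrite vE [LHS]big_mkcond; apply: eq_bigr => j _.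
    by case: ifP => // _; rewrite scale0r.
  by case: ifP => [/eqP //|_]; rewrite eqxx.
have /choice[s hs] := fun j => comp_torus_eigen (we j).
pose D := flatten [seq [seq (lin x.2, (x.1, e j)) | x <- s j] | j <- enum 'I_m & (0 < e j)%N].
have memD u : u \in D -> exists j x, [/\ x \in s j, (0 < e j)%N & u = (lin x.2, (x.1, e j))].
  move=> /flattenP[_ /mapP[j + ->] /mapP[x xs ->]]; rewrite mem_filter => /andP[ej _].
  by exists j, x.
have D_comp u d z : u \in D -> @gr_comp _ _ Z d z -> @gr_comp _ _ Z (u.2.2 + d) (smul u.1 z).
  move=> /memD[j [x [xs ej ->]]] /=; apply: smul_deg; apply: linear_form_homog => i.
  exact: cw_deg (proj1 (proj1 (hs j) x xs)).
have D_act u t z : u \in D -> (forall i, t i != 0) ->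
    gr_act (torus t) (smul u.1 z) = zpow t u.2.1 *: smul u.1 (gr_act (torus t) z).
  move=> /memD[j [x [xs ej ->]]] t0 /=.
  pose M : 'M[K]_m := \matrix_(i, k) cw (gr_act (torus t) (w k)) i.
  have hM : mx_repr w (@gr_act _ _ W (torus t)) M.
    by move=> k; rewrite {1}[gr_act _ _]cwE; apply: eq_bigr => i _; rewrite mxE.
  set v := x.2; have wt : weight_vector (@gr_act _ _ W) x.1 v := proj2 (proj1 (hs j) x xs).
  have actE i : \sum_k cw v k * M i k = zpow t x.1 * cw v i.
    have E := wt t t0; rewrite {2}[v]cwE scaler_sumr in E.
    have : \sum_i (\sum_k cw v k * M i k) *: w i = \sum_i (zpow t x.1 * cw v i) *: w i.
      under [RHS]eq_bigr do rewrite -scalerA.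
      rewrite -E.
      have -> : gr_act (torus t) v = \sum_k cw v k *: gr_act (torus t) (w k).
        rewrite {1}[v]cwE; apply: linear_comb.
        have actW_linear := act_linear (gr_rational W) (torus_unit t0).
        exact: actW_linear.
      under [RHS]eq_bigr => k _ do rewrite hM.
      rewrite comb_of_combs; apply: eq_bigr => k _; congr (_ *: _).
      by apply: eq_bigr => l _; rewrite mulrC.
    by move/(basis_coord bas).
  rewrite (equiv _ _ (torus_unit t0) hM) -smulZl; congr (smul _ _).
  rewrite /sym_act raddf_sum /= /lin scaler_sumr.
  under eq_bigr => k _ do rewrite comp_mpolyZ comp_mpolyXU -tnth_nth tnth_mktuple scaler_sumr.
  rewrite exchange_big; apply: eq_bigr => i _.
  rewrite [RHS]scalerA -actE; rewrite scaler_suml; apply: eq_bigr => k _.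
  by rewrite scalerA.
have [N [r [y [yN gen]]]] : exists N r (y : 'I_r -> nat -> Z),
    (forall i d, @gr_comp _ _ Z d (y i d)) /\
    forall z, exists p : 'I_r -> {mpoly K[m]}, z = \sum_i smul (p i) (\sum_(d < N) y i d).
  have [r [y gen]] := fg; have [dec _] := gr_direct Z.
  have /choice[f hf] : forall i, exists Nx : nat * (nat -> Z),
      (forall d, @gr_comp _ _ Z d (Nx.2 d)) /\ y i = \sum_(d < Nx.1) Nx.2 d.
    by move=> i; have [N [x hx]] := dec (y i); exists (N, x).
  pose N := (\max_i (f i).1)%N.
  exists N, r, (fun i d => if (d < (f i).1)%N then (f i).2 d else 0); split=> [i d|z].
    case: ifP => _; first exact: (proj1 (hf i)).
    by have [k [b /basis_subspace[]]] := @gr_fin_dim _ _ Z d.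
  have [p ->] := gen z; exists p; apply: eq_bigr => i _; congr smul.
  rewrite {1}(proj2 (hf i)) (big_ord_widen N (f i).2) ?leq_bigmax //.
  by rewrite big_mkcond.
have [Y [Yw Ysp]] := below_torus_eigen Z N.
pose us := [seq (u.1, u.2.2) | u <- D].
pose Sp := span (fun v => exists j mu,
  [/\ (j < size Y)%N, size mu = size D & v = mon_vec smul D Y (j :: mu)]).
have SpY v : (exists2 y, y \in Y & v = y.1) -> Sp v.
  move=> [x xY ->]; apply: span_in; exists (index x Y), (nseq (size D) 0%N).
  rewrite index_mem size_nseq; split=> //=; rewrite nth_index //.
  have := mon_weight0 us; rewrite size_map => ->.
  by rewrite -[1]mpolyC1 sC scale1r.
have sm mu : size mu = size D -> forall v, Sp v -> Sp (smul (mon_weight us mu) v).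
  move=> smu; apply: span_map => // _ [j [nu [jY snu ->]]]; apply: span_in.
  exists j, (madd mu nu); rewrite size_madd ?smu //=.
  by rewrite mon_weight_madd ?size_map // sM.
have SpX j v : Sp v -> Sp (smul 'X_j v).
  have [e0|ej] := posnP (e j).
    apply: span_map => // _ [k [mu [kY smu ->]]] /=.
    rewrite -sM mulrC sM; apply: sm => //.
    set x := nth _ _ _; have [xN xc _] := Yw x (mem_nth _ kY).
    have h : @gr_comp _ _ Z x.2.2 (smul 'X_j x.1).
      have := smul_deg 0%N _ 'X_j _ _ xc; rewrite add0n; apply=> mu'.
      rewrite msuppX inE => /eqP ->; rewrite (bigD1 j) //= mnm1E eqxx e0 mul0n add0n.
      by rewrite big1 // => i ij; rewrite mnm1E eq_sym (negPf ij) muln0.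
    exact: span_sub SpY _ (Ysp _ _ xN h).
  move=> Sv; have -> : 'X_j = \sum_(x <- s j) lin x.2.
    have E : (fun i => \sum_(x <- s j) cw x.2 i) =1 (fun i => (i == j)%:R).
      apply: (basis_coord bas); rewrite [RHS](bigD1 j) //= eqxx scale1r [X in _ = _ + X]big1.
        rewrite addr0 [RHS](proj2 (hs j)); under eq_bigr do rewrite scaler_suml.
        by rewrite exchange_big; apply: eq_bigr => x _; rewrite -cwE.
      by move=> k /negPf ->; rewrite scale0r.
    rewrite /lin exchange_big (bigD1 j) //= -scaler_suml E eqxx scale1r big1 ?addr0 //.
    by move=> k kj; rewrite -scaler_suml E (negPf kj) scale0r.
  rewrite (sym_module_sum _ _ _ _ modS) big_seq; apply: span_sum => x xs.
  have xD : (lin x.2, e j) \in us.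
    apply/mapP; exists (lin x.2, (x.1, e j)) => //; apply/flattenP.
    exists [seq (lin x.2, (x.1, e j)) | x <- s j]; last exact: map_f.
    by apply: map_f; rewrite mem_filter ej mem_enum.
  have [mu smu /= <-] := mon_weight1 xD.
  by apply: sm; rewrite // smu size_map.
have SpP p v : Sp v -> Sp (smul p v).
  rewrite [p]mpolyE (sym_module_sum _ _ _ _ modS) => Sv; apply: span_sum => mu _.
  rewrite smulZl; apply: spanZ; rewrite mpolyXE_id.
  elim/big_ind: _ v Sv => [v|p1 p2 h1 h2 v Sv|j _ v Sv].
  - by rewrite -[1]mpolyC1 sC scale1r.
  - by rewrite sM; apply: h1; apply: h2.
  elim: (mu j) => [|k IH]; first by rewrite expr0 -[1]mpolyC1 sC scale1r.
  by rewrite exprS sM; apply: SpX.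
exists [seq u.2 | u <- D].
have [|g gY|g t gY t0|z|P hP] := @equivariant_hilbert_series K n Z charK
  (fun t => gr_act (torus t)) (@gr_comp _ _ Z)
  (fun t t0 => act_linear (gr_rational Z) (torus_unit t0))
  (@gr_fin_dim _ _ Z) (gr_direct Z) m smul modS D Y _ D_comp D_act _ _ _ chi
  (fun d t t0 => chiZ d t t0).
- by move=> u /memD[j [x [_ ej ->]]].
- by case: (Yw _ gY).
- by case: (Yw _ gY) => _ _; apply.
- have [p ->] := gen z; apply: span_sum => i _; apply: SpP; apply: span_sum => d _.
  exact: span_sub SpY _ (Ysp _ _ (ltn_ord d) (yN i d)).
by exists P; split=> //; apply/allP => _ /mapP[u /memD[j [x [_ ej ->]]] ->].
Qed.

End CharactersAreRational.

(** * Regular functions and matrix representations *)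

Section RegularFunctions.
Variables (K : fieldType) (n : nat).
Implicit Types (r : 'M[K]_n -> K).

Lemma eq_regular r r' : (forall g, g \in unitmx -> r g = r' g) ->
  regular_GL r -> regular_GL r'.
Proof. by move=> rr' [p [k rE]]; exists p, k => g gu; rewrite -rr' // rE. Qed.

Lemma regular_poly (p : {mpoly K[n * n]}) :
  regular_GL (fun g => p.@[fun i => mxvec g 0 i]).
Proof. by exists p, 0%N => g _; rewrite expr0 divr1. Qed.

Lemma regular_const c : regular_GL (fun _ : 'M[K]_n => c).
Proof. by apply: eq_regular (regular_poly c%:MP) => g _; rewrite mevalC. Qed.

Lemma regular_entry i j : regular_GL (fun g : 'M[K]_n => g i j).
Proof.
apply: eq_regular (regular_poly 'X_(mxvec_index i j)) => g _.
by rewrite mevalXU mxvecE.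
Qed.

Lemma regularM r r' : regular_GL r -> regular_GL r' -> regular_GL (fun g => r g * r' g).
Proof.
move=> [p [k rE]] [p' [k' rE']]; exists (p * p'), (k + k')%N => g gu.
by rewrite rE // rE' // mevalM exprD invfM mulrACA.
Qed.

Lemma regular_det_poly : exists D : {mpoly K[n * n]},
  forall g, D.@[fun i => mxvec g 0 i] = \det g.
Proof.
exists (\det (\matrix_(i, j) 'X_(mxvec_index i j))) => g.
rewrite -[LHS]/((meval _ : {rmorphism _ -> _}) _) -det_map_mx; congr (\det _).
by apply/matrixP => i j; rewrite !mxE /= mevalXU mxvecE.
Qed.

Lemma regularD r r' : regular_GL r -> regular_GL r' -> regular_GL (fun g => r g + r' g).
Proof.
move=> [p [k rE]] [p' [k' rE']]; have [D DE] := regular_det_poly.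
exists (p * D ^+ k' + p' * D ^+ k), (k + k')%N => g gu.
have mevX v (q : {mpoly K[n * n]}) l : (q ^+ l).@[v] = q.@[v] ^+ l := rmorphXn (meval v) _ _.
have d0 l : \det g ^+ l != 0 by rewrite expf_neq0 // -unitfE -unitmxE.
rewrite rE // rE' // mevalD !mevalM !mevX !DE exprD mulrDl; congr (_ + _).
  by rewrite invfM mulrACA mulfV ?mulr1.
by rewrite [\det g ^+ k * _]mulrC invfM mulrACA mulfV ?mulr1.
Qed.

Lemma regular_sum (I : Type) (s : seq I) (P : pred I) (F : I -> 'M[K]_n -> K) :
  (forall i, P i -> regular_GL (F i)) -> regular_GL (fun g => \sum_(i <- s | P i) F i g).
Proof.
move=> h; elim: s => [|i s IH].
  by apply: eq_regular (regular_const 0) => g _; rewrite big_nil.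
case Pi : (P i); last by apply: eq_regular IH => g _; rewrite big_cons Pi.
by apply: eq_regular (regularD (h _ Pi) IH) => g _; rewrite big_cons Pi.
Qed.

Lemma regular_prod (I : Type) (s : seq I) (F : I -> 'M[K]_n -> K) :
  (forall i, regular_GL (F i)) -> regular_GL (fun g => \prod_(i <- s) F i g).
Proof.
move=> h; elim: s => [|i s IH].
  by apply: eq_regular (regular_const 1) => g _; rewrite big_nil.
by apply: eq_regular (regularM (h i) IH) => g _; rewrite big_cons.
Qed.

Lemma regular_exp r k : regular_GL r -> regular_GL (fun g => r g ^+ k).
Proof.
move=> h; apply: eq_regular (regular_prod (iota 0 k) (fun=> h)) => g _.
by rewrite big_const_seq count_predT size_iota iter_mulr mulr1.
Qed.

Lemma regular_inv_det : regular_GL (fun g : 'M[K]_n => (\det g)^-1).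
Proof. by exists 1, 1%N => g _; rewrite meval1 mul1r. Qed.

Lemma regular_det m (F : 'M[K]_n -> 'M[K]_m) :
  (forall i j, regular_GL (fun g => F g i j)) -> regular_GL (fun g => \det (F g)).
Proof.
move=> h; apply: regular_sum => s _; apply: regularM; first exact: regular_const.
exact: regular_prod.
Qed.

Lemma regular_inv i j : regular_GL (fun g : 'M[K]_n => invmx g i j).
Proof.
apply: (@eq_regular (fun g => (\det g)^-1 * \adj g i j)) => [g gu|].
  by rewrite /invmx gu [RHS]mxE.
apply: regularM; first exact: regular_inv_det.
apply: (@eq_regular (fun g => (-1) ^+ (j + i) * \det (row' j (col' i g)))) => [g _|].
  by rewrite mxE.
apply: regularM; first exact: regular_const.
apply: regular_det => k l.
by apply: eq_regular (regular_entry (lift j k) (lift i l)) => g _; rewrite !mxE.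
Qed.

Lemma regular_comp_inv r : regular_GL r -> regular_GL (fun g => r (invmx g)).
Proof.
move=> [p [k rE]].
apply: (@eq_regular (fun g => (\sum_(mu <- msupp p) p@_mu *
    \prod_i (mxvec (invmx g) 0 i) ^+ mu i) * (\det g) ^+ k)) => [g gu|].
  by rewrite rE ?unitmx_inv // mevalE det_inv exprVn invrK.
apply: regularM; last by apply: regular_exp; apply: regular_det => i j; apply: regular_entry.
apply: regular_sum => mu _; apply: regularM; first exact: regular_const.
apply: regular_prod => i; apply: regular_exp; case/mxvec_indexP: i => i j.
by apply: eq_regular (regular_inv i j) => g _; rewrite mxvecE.
Qed.

(** For a matrix representation it suffices that the entries are regular: the
    inverse of det (rho g) is det (rho (g^-1)). *)
Lemma entries_morphism_GL m (rho : 'M[K]_n -> 'M[K]_m) :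
    rho 1%:M = 1%:M ->
    (forall g h, g \in unitmx -> h \in unitmx -> rho (g *m h) = rho g *m rho h) ->
    (forall i j, regular_GL (fun g => rho g i j)) ->
  morphism_GL rho.
Proof.
move=> rho1 rhoM reg.
have rhoV g : g \in unitmx -> rho g *m rho (invmx g) = 1%:M.
  by move=> gu; rewrite -rhoM ?unitmx_inv // mulmxV.
have rho_unit g : g \in unitmx -> rho g \in unitmx.
  by move=> gu; case: (mulmx1_unit (rhoV g gu)).
split=> // r [p [k rE]].
apply: (@eq_regular (fun g => (\sum_(mu <- msupp p) p@_mu *
    \prod_i (mxvec (rho g) 0 i) ^+ mu i) * (\det (rho (invmx g))) ^+ k)) => [g gu|].
  rewrite rE ?rho_unit // mevalE; congr (_ * _); rewrite -exprVn; congr (_ ^+ _).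
  have := congr1 determinant (rhoV g gu); rewrite det_mulmx det1 => E.
  apply: (mulfI (_ : \det (rho g) != 0)); last by rewrite E mulfV // -unitfE -unitmxE rho_unit.
  by rewrite -unitfE -unitmxE rho_unit.
apply: regularM.
  apply: regular_sum => mu _; apply: regularM; first exact: regular_const.
  apply: regular_prod => i; apply: regular_exp; case/mxvec_indexP: i => i j.
  by apply: eq_regular (reg i j) => g _; rewrite mxvecE.
apply: regular_exp.
by apply: (regular_comp_inv (r := fun g => \det (rho g))); apply: regular_det.
Qed.

End RegularFunctions.

Section MatrixRepresentations.
Variables (K : fieldType) (n : nat).

(** A matrix representation in a basis of weight vectors: its character is the
    sum of the t^(wt i). *)
Record mat_rep m (rho : 'M[K]_n -> 'M[K]_m) (wt : 'I_m -> 'rV[int]_n) : Prop := MatRep {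
  mat_rep1 : rho 1%:M = 1%:M;
  mat_repM : forall g h, g \in unitmx -> h \in unitmx -> rho (g *m h) = rho g *m rho h;
  mat_rep_regular : forall i j, regular_GL (fun g => rho g i j);
  mat_rep_torus : forall t, (forall i, t i != 0) ->
    rho (torus t) = diag_mx (\row_i zpow t (wt i))
}.

Definition graded_by m (rho : 'M[K]_n -> 'M[K]_m) (e : 'I_m -> nat) : Prop :=
  forall g i j, g \in unitmx -> rho g i j != 0 -> e i = e j.

Lemma graded_by_const m (rho : 'M[K]_n -> 'M[K]_m) d : graded_by rho (fun=> d).
Proof. by []. Qed.

Lemma mat_rep_std : mat_rep (fun g => g) (fun i => \row_j ((j == i)%:R : int)).
Proof.
split=> //; first exact: regular_entry.
move=> t t0; rewrite /torus; congr diag_mx; apply/rowP => i; rewrite !mxE.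
rewrite /zpow (bigD1 i) //= mxE eqxx expr1z big1 ?mulr1 // => j /negPf ji.
by rewrite mxE ji expr0z.
Qed.

Lemma mat_rep_triv : mat_rep (fun=> 1%:M : 'M[K]_1) (fun=> 0).
Proof.
split=> // [g h _ _|i j|t t0]; first by rewrite mulmx1.
  exact: regular_const.
rewrite -diag_const_mx; congr diag_mx; apply/rowP => i.
by rewrite !mxE zpow0.
Qed.

Lemma mat_rep_inv_det :
  mat_rep (fun g => (\det g)^-1%:M : 'M[K]_1) (fun=> \row_i (-1 : int)).
Proof.
split=> [|g h gu hu|i j|t t0].
- by rewrite det1 invr1.
- by rewrite det_mulmx invfM -scalar_mxM.
- apply: (@eq_regular _ _ (fun g => (\det g)^-1 * (i == j)%:R)) => [g _|].
    by rewrite mxE mulr_natr.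
  by apply: regularM; [apply: regular_inv_det | apply: regular_const].
rewrite det_torus -diag_const_mx; congr diag_mx; apply/rowP => i.
rewrite !mxE /zpow -prodfV; apply: eq_bigr => j _.
by rewrite mxE.
Qed.

Lemma mat_rep_tensor m1 m2 (rho1 : 'M[K]_n -> 'M[K]_m1) (rho2 : 'M[K]_n -> 'M[K]_m2) wt1 wt2 :
  mat_rep rho1 wt1 -> mat_rep rho2 wt2 ->
  mat_rep (fun g => rho1 g *t rho2 g)
    (fun k => wt1 (mxtens_unindex k).1 + wt2 (mxtens_unindex k).2).
Proof.
move=> [r1 rM rr rt] [r1' rM' rr' rt']; split=> [|g h gu hu|k l|t t0].
- rewrite r1 r1'; apply/matrixP => k l; rewrite !mxE.
  case: (mxtens_indexP k) => i j; case: (mxtens_indexP l) => i' j'.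
  rewrite !mxtens_indexK /= (can_eq (@mxtens_indexK _ _)) xpair_eqE.
  by rewrite -natrM mulnb.
- by rewrite rM // rM' // tensmx_mul.
- apply: eq_regular (regularM (rr (mxtens_unindex k).1 (mxtens_unindex l).1)
    (rr' (mxtens_unindex k).2 (mxtens_unindex l).2)) => g _.
  by rewrite mxE.
rewrite rt // rt' //; apply/matrixP => k l; rewrite !mxE.
case: (mxtens_indexP k) => i j; case: (mxtens_indexP l) => i' j'.
rewrite !mxtens_indexK /= (can_eq (@mxtens_indexK _ _)) xpair_eqE zpowD //.
by case: (i == i') (j == j') => [] []; rewrite ?mulr1n ?mulr0n ?mulr0 ?mul0r.
Qed.

Definition sum_case (T : Type) m1 m2 (f1 : 'I_m1 -> T) (f2 : 'I_m2 -> T) (i : 'I_(m1 + m2)) : T :=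
  match split i with inl j => f1 j | inr j => f2 j end.

Lemma mat_rep_sum m1 m2 (rho1 : 'M[K]_n -> 'M[K]_m1) (rho2 : 'M[K]_n -> 'M[K]_m2) wt1 wt2 :
  mat_rep rho1 wt1 -> mat_rep rho2 wt2 ->
  mat_rep (fun g => block_mx (rho1 g) 0 0 (rho2 g)) (sum_case wt1 wt2).
Proof.
move=> [r1 rM rr rt] [r1' rM' rr' rt']; split=> [|g h gu hu|k l|t t0].
- by rewrite r1 r1' -scalar_mx_block.
- by rewrite rM // rM' // mulmx_block !mulmx0 !mul0mx !addr0 !add0r.
- case: (split_ordP k) => i ->; case: (split_ordP l) => j ->.
  + by apply: eq_regular (rr i j) => g _; rewrite block_mxEul.
  + by apply: eq_regular (regular_const _ 0) => g _; rewrite block_mxEur mxE.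
  + by apply: eq_regular (regular_const _ 0) => g _; rewrite block_mxEdl mxE.
  by apply: eq_regular (rr' i j) => g _; rewrite block_mxEdr.
rewrite rt // rt' // -diag_mx_row; congr diag_mx; apply/rowP => i.
rewrite !mxE /sum_case; case: split_ordP => j _; by rewrite mxE.
Qed.

Lemma graded_by_sum m1 m2 (rho1 : 'M[K]_n -> 'M[K]_m1) (rho2 : 'M[K]_n -> 'M[K]_m2) e1 e2 :
  graded_by rho1 e1 -> graded_by rho2 e2 ->
  graded_by (fun g => block_mx (rho1 g) 0 0 (rho2 g)) (sum_case e1 e2).
Proof.
move=> g1 g2 g k l gu; rewrite /sum_case.
case: split_ordP => i ->; case: split_ordP => j ->.
- by rewrite block_mxEul; apply: g1.
- by rewrite block_mxEur mxE eqxx.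
- by rewrite block_mxEdl mxE eqxx.
by rewrite block_mxEdr; apply: g2.
Qed.

End MatrixRepresentations.

(** * Free modules over a symmetric algebra *)

Section SymmetricAlgebra.
Variables (K : fieldType) (m : nat).
Implicit Types (M N : 'M[K]_m) (p q : {mpoly K[m]}).

Lemma sym_actX M j : sym_act M 'X_j = \sum_i M i j *: 'X_i.
Proof. by rewrite /sym_act comp_mpolyXU -tnth_nth tnth_mktuple. Qed.

Lemma sym_actXE M mu : sym_act M 'X_[mu] = \prod_j (\sum_i M i j *: 'X_i) ^+ mu j.
Proof. by rewrite /sym_act comp_mpolyX; apply: eq_bigr => j _; rewrite tnth_mktuple. Qed.

HB.instance Definition _ M := GRing.RMorphism.copy (sym_act M)
  (comp_mpoly [tuple \sum_i M i j *: 'X_i | j < m]).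
HB.instance Definition _ M := GRing.Linear.copy (sym_act M)
  (comp_mpoly [tuple \sum_i M i j *: 'X_i | j < m]).

Lemma sym_actE M p : sym_act M p = \sum_(mu <- msupp p) p@_mu *: sym_act M 'X_[mu].
Proof.
by rewrite {1}[p]mpolyE linear_sum; apply: eq_bigr => mu _; rewrite linearZ.
Qed.

Lemma sym_act1 p : sym_act 1%:M p = p.
Proof.
rewrite -[RHS]comp_mpoly_id /sym_act; congr (_ \mPo _); apply: eq_from_tnth => j.
rewrite !tnth_mktuple (bigD1 j) //= mxE eqxx scale1r big1 ?addr0 // => i /negPf ij.
by rewrite mxE ij scale0r.
Qed.

Lemma sym_act_mulmx M N p : sym_act (M *m N) p = sym_act M (sym_act N p).
Proof.
rewrite sym_actE [sym_act N p]sym_actE linear_sum; apply: eq_bigr => mu _.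
rewrite linearZ; congr (_ *: _).
rewrite !sym_actXE rmorph_prod; apply: eq_bigr => j _; rewrite rmorphXn; congr (_ ^+ _).
rewrite /= linear_sum; under [RHS]eq_bigr => i _ do rewrite linearZ /= sym_actX scaler_sumr.
rewrite exchange_big; apply: eq_bigr => i _.
rewrite mxE scaler_suml; apply: eq_bigr => k _.
by rewrite scalerA mulrC.
Qed.

Lemma sym_act_diag (d : 'rV[K]_m) mu :
  sym_act (diag_mx d) 'X_[mu] = (\prod_i d 0 i ^+ mu i) *: 'X_[mu].
Proof.
rewrite sym_actXE mpolyXE_id -scaler_prod; apply: eq_bigr => j _.
rewrite (bigD1 j) //= mxE eqxx mulr1n big1 ?addr0 => [|i /negPf ij].
  by rewrite exprZn.
by rewrite mxE ij mulr0n scale0r.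
Qed.

Variable e : 'I_m -> nat.

Definition mon_degree (mu : 'X_{1..m}) : nat := (\sum_i e i * mu i)%N.

Lemma mon_degreeD mu nu : mon_degree (mu + nu)%MM = (mon_degree mu + mon_degree nu)%N.
Proof. by rewrite -big_split; apply: eq_bigr => i _; rewrite mnmDE mulnDr. Qed.

Lemma mon_degree0 : mon_degree 0%MM = 0%N.
Proof. by apply: big1 => i _; rewrite mnm0E muln0. Qed.

Lemma sym_homogP k p : sym_homog e k p <-> forall mu, p@_mu != 0 -> mon_degree mu = k.
Proof. by split=> h mu; have := h mu; rewrite mcoeff_msupp. Qed.

Lemma sym_homog_sum (I : Type) (s : seq I) (P : pred I) (F : I -> {mpoly K[m]}) k :
  (forall i, P i -> sym_homog e k (F i)) -> sym_homog e k (\sum_(i <- s | P i) F i).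
Proof.
move=> h; apply: big_ind => // [mu|p q hp hq]; first by rewrite msupp0.
apply/sym_homogP => mu; rewrite mcoeffD => pq.
have [p0|/(proj1 (sym_homogP _ _) hp) //] := eqVneq p@_mu 0.
by apply: (proj1 (sym_homogP _ _) hq); move: pq; rewrite p0 add0r.
Qed.

Lemma sym_homogZ k c p : sym_homog e k p -> sym_homog e k (c *: p).
Proof.
move=> /sym_homogP h; apply/sym_homogP => mu; rewrite mcoeffZ mulf_eq0 negb_or.
by move=> /andP[_ /h].
Qed.

Lemma sym_homogM k l p q : sym_homog e k p -> sym_homog e l q -> sym_homog e (k + l) (p * q).
Proof.
move=> hp hq mu /msuppM_le/allpairsP[[a b] /= [/hp <- /hq <- ->]].
exact: mon_degreeD.
Qed.

Lemma sym_homog1 : sym_homog e 0 (1 : {mpoly K[m]}).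
Proof. by move=> mu; rewrite msupp1 inE => /eqP ->; apply: mon_degree0. Qed.

Lemma sym_act_homog M k p : (forall i j, M i j != 0 -> e i = e j) ->
  sym_homog e k p -> sym_homog e k (sym_act M p).
Proof.
move=> Me hp; rewrite sym_actE big_seq; apply: sym_homog_sum => mu /hp <-.
apply: sym_homogZ; rewrite sym_actXE.
elim/big_ind2: _ => [|k1 p1 k2 p2|j _]; [exact: sym_homog1 | exact: sym_homogM |].
elim: (mu j) => [|a IH]; first by rewrite muln0 expr0; apply: sym_homog1.
rewrite mulnS exprS; apply: sym_homogM => //; apply: linear_form_homog => i.
exact: Me.
Qed.

Section Regularity.
Variables (n : nat).
Implicit Types F : 'M[K]_n -> {mpoly K[m]}.

Definition regular_coeffs F : Prop := forall nu, regular_GL (fun g => (F g)@_nu).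

Lemma regular_coeffs_const p : regular_coeffs (fun=> p).
Proof. by move=> nu; apply: regular_const. Qed.

Lemma regular_coeffsZ c F : regular_GL c -> regular_coeffs F ->
  regular_coeffs (fun g => c g *: F g).
Proof.
move=> hc hF nu; apply: eq_regular (regularM hc (hF nu)) => g _.
by rewrite mcoeffZ.
Qed.

Lemma regular_coeffs_sum (I : Type) (s : seq I) (F : I -> 'M[K]_n -> {mpoly K[m]}) :
  (forall i, regular_coeffs (F i)) -> regular_coeffs (fun g => \sum_(i <- s) F i g).
Proof.
move=> h nu; apply: (@eq_regular _ _ (fun g => \sum_(i <- s) (F i g)@_nu)) => [g _|].
  by rewrite raddf_sum.
by apply: regular_sum => i _; apply: h.
Qed.

Lemma regular_coeffsM F F' : regular_coeffs F -> regular_coeffs F' ->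
  regular_coeffs (fun g => F g * F' g).
Proof.
move=> h h' nu; apply: (@eq_regular _ _ (fun g => _)) => [g _|].
  by rewrite mcoeffM.
by apply: regular_sum => i _; apply: regularM.
Qed.

Lemma regular_coeffs_prod (I : Type) (s : seq I) (F : I -> 'M[K]_n -> {mpoly K[m]}) :
  (forall i, regular_coeffs (F i)) -> regular_coeffs (fun g => \prod_(i <- s) F i g).
Proof.
move=> h; elim: s => [|i s IH] nu.
  by apply: eq_regular (regular_coeffs_const 1 nu) => g _; rewrite big_nil.
by apply: eq_regular (regular_coeffsM (h i) IH nu) => g _; rewrite big_cons.
Qed.

Lemma sym_act_regular (rho : 'M[K]_n -> 'M[K]_m) p :
  (forall i j, regular_GL (fun g => rho g i j)) ->
  regular_coeffs (fun g => sym_act (rho g) p).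
Proof.
move=> reg nu; apply: (@eq_regular _ _ (fun g =>
    (\sum_(mu <- msupp p) p@_mu *: \prod_j \prod_(k <- iota 0 (mu j)) \sum_i rho g i j *: 'X_i)@_nu)).
  move=> g _; rewrite sym_actE; congr (_@__); apply: eq_bigr => mu _.
  rewrite sym_actXE; congr (_ *: _); apply: eq_bigr => j _.
  by rewrite big_const_seq count_predT size_iota iter_mulr mulr1.
move: nu; apply: regular_coeffs_sum => mu.
apply: regular_coeffsZ; first exact: regular_const.
do 2!apply: regular_coeffs_prod => ?; apply: regular_coeffs_sum => i.
by apply: regular_coeffsZ; last exact: regular_coeffs_const.
Qed.

End Regularity.

End SymmetricAlgebra.

Lemma mx_repr_hom (K : fieldType) (n : nat) (Z : lmodType K)
    (act : 'M[K]_n -> Z -> Z) (U : Z -> Prop) k (b : 'I_k -> Z) (rho : 'M[K]_n -> 'M[K]_k) :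
    GL_action act -> is_basis U b ->
    (forall g, g \in unitmx -> mx_repr b (act g) (rho g)) ->
  rho 1%:M = 1%:M /\
  forall g h, g \in unitmx -> h \in unitmx -> rho (g *m h) = rho g *m rho h.
Proof.
move=> [lin act1 actM] bas hrho; split=> [|g h gu hu]; apply/matrixP => i j.
  have := hrho 1%:M (unitmx1 _ _) j; rewrite act1 => E.
  have : \sum_i rho 1%:M i j *: b i = \sum_i (i == j)%:R *: b i by rewrite -E delta_comb.
  by move/(basis_coord bas) => ->; rewrite mxE.
have ghu : g *m h \in unitmx by rewrite unitmx_mul gu.
have := hrho _ ghu j; rewrite actM // hrho //.
rewrite linear_comb; last exact: lin.
under eq_bigr => l _ do rewrite hrho //.
by rewrite comb_of_combs => /(basis_coord bas) <-; rewrite mxE.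
Qed.

(** In a space with coordinate functions co, the matrix entries of g on a basis of
    an invariant subspace are linear combinations of coordinates of g . b_j: the
    coordinate matrix of a basis has a one-sided inverse. *)
Lemma rational_by_coordinates (K : fieldType) (n : nat) (Z : lmodType K)
    (act : 'M[K]_n -> Z -> Z) (X : eqType) (co : X -> Z -> K) :
    GL_action act ->
    (forall x c z z', co x (c *: z + z') = c * co x z + co x z') ->
    (forall x z, regular_GL (fun g => co x (act g z))) ->
    (forall z, exists s : seq X, forall x, co x z != 0 -> x \in s) ->
    (forall z, (forall x, co x z = 0) -> z = 0) ->
  forall (U : Z -> Prop) k (b : 'I_k -> Z), is_basis U b -> GL_invariant act U ->
  exists2 rho : 'M[K]_n -> 'M[K]_k, morphism_GL rho &
    forall g, g \in unitmx -> mx_repr b (act g) (rho g).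
Proof.
move=> act_GL co_lin co_reg co_fin co_sep U k b bas inv.
have co0 x : co x 0 = 0 by have := co_lin x (-1) 0 0; rewrite scaler0 addr0 mulN1r addNr.
have co_sum x (c : 'I_k -> K) (v : 'I_k -> Z) :
    co x (\sum_i c i *: v i) = \sum_i c i * co x (v i).
  elim/big_rec2: _ => [|i y z _ IH]; first exact: co0.
  by rewrite co_lin IH.
have /choice[sp hsp] := fun j => co_fin (b j).
pose s := flatten [seq sp j | j <- enum 'I_k].
pose A := \matrix_(j < k, x < size s) co (tnth (in_tuple s) x) (b j).
have [C AC] : exists C, A *m C = 1%:M.
  apply/row_freeP/inj_row_free => v vA; apply/rowP => i; rewrite [RHS]mxE.
  apply: (proj2 bas (fun i => v 0 i)); apply: co_sep => x; rewrite co_sum.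
  have [xs|xs] := boolP (x \in s).
    have /tnthP[l ->] : x \in in_tuple s by [].
    have /rowP/(_ l) := vA; rewrite !mxE => E; rewrite -[RHS]E.
    by apply: eq_bigr => j _; rewrite mxE.
  rewrite big1 // => j _; apply/eqP; rewrite mulf_eq0; apply/orP; right.
  apply: contraNT xs => /hsp xj; apply/flattenP; exists (sp j) => //.
  by apply: map_f; rewrite mem_enum.
have /choice[rho hrho] : forall g, exists M : 'M[K]_k, g \in unitmx -> mx_repr b (act g) M.
  move=> g; have [gu|gu] := boolP (g \in unitmx); last by exists 0.
  have /choice[c hc] : forall j, exists c : 'I_k -> K, act g (b j) = \sum_i c i *: b i.
    by move=> j; apply/(proj1 bas)/inv => //; apply: basis_mem bas.
  by exists (\matrix_(i, j) c j i) => _ j; rewrite hc; apply: eq_bigr => i _; rewrite mxE.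
have [rho1 rhoM] := mx_repr_hom act_GL bas hrho.
exists rho => //; apply: entries_morphism_GL => //.
move=> i j; apply: (@eq_regular _ _ (fun g => \sum_x co (tnth (in_tuple s) x) (act g (b j)) * C x i)).
  move=> g gu; rewrite hrho //; under eq_bigr => x _ do rewrite co_sum mulr_suml.
  rewrite exchange_big /= (bigD1 i) //= [X in _ + X]big1 ?addr0.
    rewrite -[RHS]mulr1; have /matrixP/(_ i i) := AC; rewrite !mxE eqxx mulr1n => <-.
    by rewrite mulr_sumr; apply: eq_bigr => x _; rewrite mxE mulrA.
  move=> l li; have /matrixP/(_ l i) := AC; rewrite !mxE (negPf li) mulr0n => E.
  rewrite -[RHS](mulr0 (rho g l j)) -[X in _ = _ * X]E mulr_sumr; apply: eq_bigr => x _.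
  by rewrite mxE mulrA.
by apply: regular_sum => x _; apply: regularM; [apply: co_reg | apply: regular_const].
Qed.

Lemma wdeg_map (I : Type) (s : seq I) (e mu : I -> nat) :
  wdeg (map e s) (map mu s) = (\sum_(i <- s) e i * mu i)%N.
Proof. by elim: s => [|i s IH] /=; rewrite ?big_nil // big_cons IH. Qed.

Lemma mon_weight_map (R : comNzRingType) (I : Type) (s : seq I) (w : I -> R * nat) (mu : I -> nat) :
  mon_weight (map w s) (map mu s) = \prod_(i <- s) (w i).1 ^+ mu i.
Proof. by elim: s => [|i s IH] /=; rewrite ?big_nil // big_cons IH. Qed.

(** The Hilbert series of a polynomial ring: the ideal of all monomials is stable
    under shifting, and its slice is again the ideal of all monomials. *)
Lemma gen_fun_all (R : comNzRingType) (ws : seq (R * nat)) d : all (leq 1) (map snd ws) ->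
  smulp (gen_fun ws predT) (\prod_(w <- ws) (1 - w.1 *: 'X^(w.2))) d = (1 : {poly R})`_d.
Proof.
elim: ws d => [|w ws IH] d pos.
  rewrite big_nil smulp1 /gen_fun /= /monomials coef1.
  by case: eqP => _; rewrite ?big_cons big_nil ?addr0.
have /= /andP[_ pos'] := pos; rewrite -IH // big_cons -smulpA; apply: eq_smulp => {}d.
rewrite smulpBr smulp1 gen_fun_cons //.
rewrite (@eq_smulp _ (gen_fun (w :: ws) (shift predT)) (gen_fun (w :: ws) predT)) ?addrK //.
by apply: eq_gen_fun => // -[|a mu].
Qed.

Section FreeModule.
Variables (K : fieldType) (n : nat).
Variables (m : nat) (rhoW : 'M[K]_n -> 'M[K]_m) (wtW : 'I_m -> 'rV[int]_n) (e : 'I_m -> nat).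
Variables (r : nat) (rhoV : 'M[K]_n -> 'M[K]_r) (wtV : 'I_r -> 'rV[int]_n) (dV : 'I_r -> nat).
Hypotheses (repW : mat_rep rhoW wtW) (gradW : graded_by rhoW e) (e_pos : forall i, (0 < e i)%N).
Hypotheses (repV : mat_rep rhoV wtV) (gradV : graded_by rhoV dV).

(** S(W) (x) V, an element being given by its S(W)-coordinates on the basis of V. *)
Definition free_car : lmodType K := {ffun 'I_r -> {mpoly K[m]}}.
Implicit Types (z : free_car).

Definition free_act g z : free_car :=
  [ffun i => \sum_j rhoV g i j *: sym_act (rhoW g) (z j)].

Definition free_comp d z : Prop :=
  forall j mu, (z j)@_mu != 0 -> (mon_degree e mu + dV j)%N = d.

Lemma free_coefE c z z' j : (c *: z + z') j = c *: z j + z' j.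
Proof. by rewrite !ffunE. Qed.

Lemma free_sumE (I : Type) (s : seq I) (P : pred I) (F : I -> free_car) j :
  (\sum_(i <- s | P i) F i) j = \sum_(i <- s | P i) F i j.
Proof. by elim/big_rec2: _ => [|i y z _ <-]; rewrite ffunE. Qed.

Lemma free_actE g z i : free_act g z i = \sum_j rhoV g i j *: sym_act (rhoW g) (z j).
Proof. by rewrite ffunE. Qed.

Lemma free_carP z z' : (forall j mu, (z j)@_mu = (z' j)@_mu) -> z = z'.
Proof. by move=> h; apply/ffunP => j; apply/mpolyP. Qed.

Lemma free0E j : (0 : free_car) j = 0.
Proof. by rewrite ffunE. Qed.

Lemma free_act_linear g : linear (free_act g).
Proof.
move=> c z z'; apply/ffunP => i; rewrite free_coefE !free_actE scaler_sumr -big_split.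
apply: eq_bigr => j _; rewrite free_coefE linearP scalerDr !scalerA.
by rewrite [c * _]mulrC.
Qed.

Lemma free_GL_action : GL_action free_act.
Proof.
split=> [g _|z|g h z gu hu]; first exact: free_act_linear.
  apply/ffunP => i; rewrite free_actE (mat_rep1 repV) (mat_rep1 repW) (bigD1 i) //=.
  rewrite mxE eqxx scale1r sym_act1 big1 ?addr0 // => j /negPf ij.
  by rewrite mxE eq_sym ij scale0r.
apply/ffunP => i; rewrite (free_actE (g *m h)) (mat_repM repV gu hu) (mat_repM repW gu hu).
rewrite (free_actE g); under [RHS]eq_bigr => k _.
  rewrite free_actE [sym_act _ _]linear_sum /= scaler_sumr; under eq_bigr do rewrite linearZ scalerA.
  over.
rewrite exchange_big; apply: eq_bigr => j _; rewrite mxE scaler_suml.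
by apply: eq_bigr => k _; rewrite sym_act_mulmx.
Qed.

Lemma free_comp_invariant d : GL_invariant free_act (free_comp d).
Proof.
move=> g z gu zd i mu; rewrite free_actE raddf_sum /= => nz.
have [j] : exists j, rhoV g i j * (sym_act (rhoW g) (z j))@_mu != 0.
  apply/existsP; apply: contraNT nz => /existsPn h; apply/eqP/big1 => j _.
  by rewrite mcoeffZ; apply/eqP; have := h j; rewrite negbK.
rewrite mulf_eq0 negb_or => /andP[/(gradV gu) -> nz'].
have [z0|zj0] := eqVneq (z j) 0; first by rewrite z0 raddf0 mcoeff0 eqxx in nz'.
have [nu nuE] : exists nu, (z j)@_nu != 0.
  by exists (mlead (z j)); rewrite mleadc_eq0.
have jd : (dV j <= d)%N by rewrite -(zd _ _ nuE) leq_addl.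
suff -> : mon_degree e mu = (d - dV j)%N by rewrite subnK.
apply: (proj1 (sym_homogP _ _ _) _ _ nz'); apply: sym_act_homog => [k l|].
  exact: gradW.
by apply/sym_homogP => lam /zd <-; rewrite addnK.
Qed.

Definition free_basis (x : 'I_r * 'X_{1..m}) : free_car :=
  [ffun k => if k == x.1 then 'X_[x.2] else 0].

Definition free_weight (x : 'I_r * 'X_{1..m}) : laurent n :=
  tmon (wtV x.1) * \prod_i tmon (wtW i) ^+ x.2 i.

Let es := [seq e i | i <- enum 'I_m].
Let ws := [seq (tmon (wtW i), e i) | i <- enum 'I_m].

Let es_pos : all (leq 1) es.
Proof. by apply/allP => _ /mapP[i _ ->]. Qed.

Definition mnm_of_seq (l : seq nat) : 'X_{1..m} := [multinom nth 0%N l i | i < m].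

Lemma mnm_of_seqK l : size l = m -> [seq mnm_of_seq l i | i <- enum 'I_m] = l.
Proof.
move=> sl; apply: (@eq_from_nth _ 0%N); rewrite size_map size_enum_ord // => i im.
by rewrite (nth_map (Ordinal im)) ?size_enum_ord // mnmE nth_enum_ord.
Qed.

Lemma seq_of_mnmK (mu : 'X_{1..m}) : mnm_of_seq [seq mu i | i <- enum 'I_m] = mu.
Proof.
apply/mnmP => i; rewrite mnmE (nth_map i) ?size_enum_ord //.
by rewrite nth_ord_enum.
Qed.

Definition free_indices d : seq ('I_r * 'X_{1..m}) :=
  [seq (j, mnm_of_seq l) | j <- [seq j <- enum 'I_r | (dV j <= d)%N],
                           l <- monomials es (d - dV j)].

Lemma wdeg_seq l : size l = m -> wdeg es l = mon_degree e (mnm_of_seq l).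
Proof.
by move=> sl; rewrite -{1}(mnm_of_seqK sl) wdeg_map big_enum.
Qed.

Lemma mem_free_indices d j mu : ((j, mu) \in free_indices d) = (mon_degree e mu + dV j == d)%N.
Proof.
apply/allpairsPdep/eqP => [[k [l [+ + [-> ->]]]]|E].
  rewrite mem_filter mem_monomials // size_map size_enum_ord => /andP[kd _] /andP[/eqP sl /eqP dl].
  by rewrite -wdeg_seq // dl subnK.
have jd : (dV j <= d)%N by rewrite -E leq_addl.
exists j, [seq mu i | i <- enum 'I_m]; rewrite mem_filter mem_enum jd seq_of_mnmK; split=> //.
by rewrite mem_monomials // !size_map eqxx -E addnK wdeg_map big_enum eqxx.
Qed.

Lemma uniq_free_indices d : uniq (free_indices d).
Proof.
apply: allpairs_uniq_dep => [|j _|[j l] [k l']]; first by rewrite filter_uniq ?enum_uniq.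
  exact: uniq_monomials.
move=> /allpairsPdep[j1 [l1 [_ + [-> ->]]]] /allpairsPdep[j2 [l2 [_ + [-> ->]]]].
rewrite !(mem_monomials _ _ es_pos) size_map size_enum_ord.
move=> /andP[/eqP s2 _] /andP[/eqP s1 _] /= /eqP.
rewrite xpair_eqE => /andP[/eqP-> /eqP E].
have := congr1 (fun mu : 'X_{1..m} => [seq mu i | i <- enum 'I_m]) E.
by rewrite !mnm_of_seqK // => ->.
Qed.

Lemma free_basis_coef (M : seq ('I_r * 'X_{1..m})) c j mu : uniq M ->
  ((\sum_(x <- M) c x *: free_basis x : free_car) j)@_mu = if (j, mu) \in M then c (j, mu) else 0.
Proof.
move=> uM; rewrite free_sumE raddf_sum /=.
have term x : ((c x *: free_basis x : free_car) j)@_mu = if x == (j, mu) then c x else 0.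
  case: x => k nu; rewrite !ffunE mcoeffZ xpair_eqE /= [j == k]eq_sym.
  case: (k =P j) => [->|_] /=; last by rewrite mcoeff0 mulr0.
  by rewrite mcoeffX; case: eqP => _; rewrite ?mulr1 ?mulr0.
under eq_bigr do rewrite term.
have [jM|jM] := boolP (_ \in M).
  by rewrite (bigD1_seq (j, mu)) //= eqxx big1 ?addr0 // => x /negPf ->.
by rewrite big_seq big1 // => x xM; case: eqP => // E; rewrite -E xM in jM.
Qed.

Lemma free_comp_basis d : is_basis (free_comp d)
  (fun i : 'I_(size (free_indices d)) => free_basis (tnth (in_tuple (free_indices d)) i)).
Proof.
apply: seq_basis => [|z|c E [j mu] jM]; first exact: uniq_free_indices.
  split=> [zd|[c ->] j mu]; last first.
    rewrite free_basis_coef ?uniq_free_indices // mem_free_indices.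
    by case: ifP => [/eqP //|_]; rewrite eqxx.
  exists (fun x => (z x.1)@_(x.2)); apply: free_carP => j mu.
  rewrite free_basis_coef ?uniq_free_indices // mem_free_indices /=.
  by case: eqP => // nd; apply/eqP; apply: contraT => /zd /nd.
have := free_basis_coef c j mu (uniq_free_indices d).
by rewrite E jM free0E mcoeff0.
Qed.

Lemma free_fin_dim d : fin_dim (free_comp d).
Proof. by eexists; eexists; apply: free_comp_basis. Qed.

Lemma free_direct : direct_decomp free_comp.
Proof.
split=> [z|N x xd x0 d dN].
  pose deg (j : 'I_r) (mu : 'X_{1..m}) := (mon_degree e mu + dV j)%N.
  pose N := (\max_j \max_(mu <- msupp (z j)) (deg j mu).+1)%N.
  pose x d : free_car := [ffun j => \sum_(mu <- msupp (z j) | deg j mu == d) (z j)@_mu *: 'X_[mu]].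
  have xE d j mu : (x d j)@_mu = if deg j mu == d then (z j)@_mu else 0.
    rewrite ffunE raddf_sum /=.
    under eq_bigr => nu _ do rewrite mcoeffZ mcoeffX.
    rewrite big_mkcond; have [mz|mz] := boolP (mu \in msupp (z j)).
      rewrite (bigD1_seq mu) ?msupp_uniq //= eqxx mulr1 big1 ?addr0 // => nu /negPf ->.
      by rewrite mulr0; case: ifP.
    rewrite big_seq big1 => [|nu nz]; first by rewrite (memN_msupp_eq0 mz); case: ifP.
    have /negPf-> : nu != mu by apply: contraNneq mz => <-.
    by rewrite mulr0; case: ifP.
  exists N, x; split=> [d j mu|]; first by rewrite xE; case: ifP => [/eqP //|_]; rewrite eqxx.
  apply: free_carP => j mu; rewrite free_sumE raddf_sum /=.
  under eq_bigr do rewrite xE.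
  have [mz|mz] := boolP (mu \in msupp (z j)); last first.
    by rewrite (memN_msupp_eq0 mz) big1 // => i _; case: ifP.
  have lt : (deg j mu < N)%N.
    apply: leq_trans (leq_bigmax j); apply: (leq_bigmax_seq (F := fun mu => (deg j mu).+1)) => //.
  rewrite (bigD1 (Ordinal lt)) //= eqxx big1 ?addr0 // => i.
  by rewrite -val_eqE /= eq_sym => /negPf ->.
apply: free_carP => j mu; rewrite free0E mcoeff0.
have [//|nz] := eqVneq (x d j)@_mu 0.
have dE := xd d _ _ nz.
have := congr1 (fun z : free_car => (z j)@_mu) x0; rewrite free_sumE raddf_sum /=.
rewrite (bigD1 (Ordinal dN)) //= big1 => [|i id]; first by rewrite addr0 free0E mcoeff0.
apply/eqP; apply: contraTT id => /xd; rewrite dE => E.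
by rewrite negbK -val_eqE /= E.
Qed.

Lemma free_rational : rational_rep free_act.
Proof.
split; first exact: free_GL_action.
  move=> z; have [N [x [xd ->]]] := proj1 free_direct z.
  exists N, (fun i => x i); split=> // i; exists (free_comp i).
  by split=> //; [apply: free_fin_dim | apply: free_comp_invariant].
apply: (@rational_by_coordinates _ _ _ _ ('I_r * 'X_{1..m})%type (fun x z => (z x.1)@_(x.2))).
- exact: free_GL_action.
- by move=> x c z z'; rewrite free_coefE mcoeffD mcoeffZ.
- move=> [j mu] z; apply: (@eq_regular _ _ (fun g =>
      (\sum_k rhoV g j k *: sym_act (rhoW g) (z k))@_mu)) => [g _|].
    by rewrite free_actE.
  move: mu; apply: regular_coeffs_sum => k.
  apply: regular_coeffsZ; first exact: (mat_rep_regular repV).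
  exact: sym_act_regular (mat_rep_regular repW).
- move=> z; exists (flatten [seq [seq (j, mu) | mu <- msupp (z j)] | j <- enum 'I_r]) => -[j mu] /=.
  rewrite -mcoeff_msupp => mz; apply/flattenP; exists [seq (j, mu) | mu <- msupp (z j)].
    by apply: map_f; rewrite mem_enum.
  exact: map_f.
move=> z h; apply: free_carP => j mu.
by rewrite free0E mcoeff0; apply: (h (j, mu)).
Qed.

Definition free_rep : gradedRep K n :=
  GradedRep free_rational free_fin_dim free_comp_invariant free_direct.

Definition free_char : pseries n := fun d => \sum_(x <- free_indices d) free_weight x.

Lemma free_basis_act x t : (forall i, t i != 0) ->
  free_act (torus t) (free_basis x) = leval t (free_weight x) *: free_basis x.
Proof.
move=> t0; case: x => j mu; apply/ffunP => i; rewrite free_actE (mat_rep_torus repV) // (mat_rep_torus repW) //.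
rewrite (bigD1 j) //= !ffunE eqxx big1 ?addr0 => [|k /negPf kj]; last first.
  by rewrite !ffunE /= kj linear0 scaler0.
rewrite sym_act_diag !mxE levalM // leval_tmon scalerA.
case: (i =P j) => [->|_]; last by rewrite mulr0n mul0r scale0r scaler0.
rewrite mulr1n; congr (_ *: _); congr (_ * _); rewrite leval_prod //.
by apply: eq_bigr => k _; rewrite mxE tmonX leval_tmon zpow_muln.
Qed.

(** The products of a monomial with a basis vector of V are a basis of weight
    vectors. *)
Lemma free_rep_char : graded_char free_rep free_char.
Proof.
move=> d t t0; rewrite /free_char leval_sum.
apply: (@seq_basis_trace _ _ _ free_basis _ _ _ (fun x => leval t (free_weight x))).
- exact: uniq_free_indices.
- exact: free_comp_basis.
by move=> x _; apply: free_basis_act.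
Qed.

(** For V = K this says that the denominator is 1 / ch S(W). *)
Lemma free_char_denom d :
  smulp free_char (denom [seq (wtW i, e i) | i <- enum 'I_m]) d =
  (\sum_j tmon (wtV j) *: 'X^(dV j) : {poly laurent n})`_d.
Proof.
have -> : denom [seq (wtW i, e i) | i <- enum 'I_m] =
    \prod_(w <- ws) (1 - w.1 *: 'X^(w.2)) :> {poly laurent n}.
  by rewrite /denom !big_map; apply: eq_bigr => u _; rewrite tmonE.
have wsE : map snd ws = es by rewrite -map_comp.
have chiE : free_char =1 fun d => \sum_j smulp (gen_fun ws predT) (tmon (wtV j) *: 'X^(dV j)) d.
  move=> {}d; rewrite /free_char big_allpairs_dep /= big_filter big_enum_cond big_mkcond /=.
  apply: eq_bigr => j _; rewrite smulp_monX; case: ifP => // _.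
  have genE k : gen_fun ws predT k = \sum_(l <- monomials es k) mon_weight ws l.
    by rewrite /gen_fun wsE.
  rewrite genE mulr_sumr; apply: eq_big_seq => l.
  rewrite (mem_monomials _ _ es_pos) size_map size_enum_ord => /andP[/eqP sl _].
  by rewrite /free_weight -[X in mon_weight ws X](mnm_of_seqK sl) mon_weight_map big_enum.
rewrite (eq_smulp _ chiE) smulp_sum.
under [LHS]eq_bigr => i _ do rewrite mulr_suml.
rewrite exchange_big coef_sum; apply: eq_bigr => j _.
rewrite -smulp_sum smulpA mulrC -smulpA (eq_smulp _ (fun d => gen_fun_all d _)) ?wsE //.
by rewrite smulp_poly mul1r.
Qed.

End FreeModule.

Section LinearRepresentation.
Variables (K : fieldType) (n : nat).

Lemma mat_rep_zero : mat_rep (fun _ : 'M[K]_n => 0 : 'M[K]_0) (fun=> 0).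
Proof.
by split=> [|g h _ _|[]//|t _]; apply/matrixP => -[].
Qed.

Lemma graded_by_zero (e : 'I_0 -> nat) : graded_by (fun _ : 'M[K]_n => 0 : 'M[K]_0) e.
Proof. by move=> g []. Qed.

Lemma no_degree (i : 'I_0) : (0 < 0)%N.
Proof. by case: i. Qed.

(** A finite dimensional graded representation is the free module on it over the
    polynomial ring in no variables. *)
Definition linear_rep m (rho : 'M[K]_n -> 'M[K]_m) wt e
    (rep : mat_rep rho wt) (grad : graded_by rho e) : gradedRep K n :=
  free_rep mat_rep_zero (graded_by_zero (fun=> 0%N)) no_degree rep grad.

End LinearRepresentation.

Section FreeModuleInClass.
Variables (K : fieldType) (n : nat).
Variables (m : nat) (rhoW : 'M[K]_n -> 'M[K]_m) (wtW : 'I_m -> 'rV[int]_n) (e : 'I_m -> nat).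
Variables (r : nat) (rhoV : 'M[K]_n -> 'M[K]_r) (wtV : 'I_r -> 'rV[int]_n) (dV : 'I_r -> nat).
Hypotheses (repW : mat_rep rhoW wtW) (gradW : graded_by rhoW e) (e_pos : forall i, (0 < e i)%N).
Hypotheses (repV : mat_rep rhoV wtV) (gradV : graded_by rhoV dV).

Local Notation Z := (free_car K m r).
Local Notation W := (free_car K 0 m).

Let smul (p : {mpoly K[m]}) (z : Z) : Z := [ffun j => p * z j].
Let w (j : 'I_m) : W := [ffun k => if k == j then 1 else 0].

Let sum_basis (c : 'I_m -> K) k : (\sum_i c i *: w i : W) k = (c k)%:MP.
Proof.
rewrite free_sumE (bigD1 k) //= big1 => [|i ik].
  by rewrite !ffunE eqxx addr0 -mul_mpolyC mulr1.
by rewrite !ffunE eq_sym (negPf ik) scaler0.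
Qed.

Let w_basis : is_basis (fun _ : W => True) w.
Proof.
split=> [z|c E i].
  split=> // _; exists (fun k => (z k)@_0%MM); apply/ffunP => k.
  by rewrite sum_basis; apply: nvar0_mpolyC.
have := sum_basis c i; rewrite E free0E => /(congr1 (mcoeff 0%MM)).
by rewrite mcoeff0 mcoeffC eqxx mulr1.
Qed.

Let w_homogeneous j : free_comp (fun _ : 'I_0 => 0%N) e (e j) (w j).
Proof.
move=> k mu; rewrite ffunE; have [->|_] := eqVneq k j; last by rewrite mcoeff0 eqxx.
by rewrite /mon_degree big_ord0.
Qed.

Let smul_homogeneous k d p (z : Z) :
  sym_homog e k p -> free_comp e dV d z -> free_comp e dV (k + d) (smul p z).
Proof.
move=> hp hz j mu; rewrite ffunE -mcoeff_msupp => /msuppM_le/allpairsP[[a b] /=].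
case=> /hp ka; rewrite mcoeff_msupp => /hz db ->.
by rewrite mon_degreeD -addnA db -ka.
Qed.

Let smul_equivariant g p (z : Z) :
  free_act rhoW rhoV g (smul p z) = smul (sym_act (rhoW g) p) (free_act rhoW rhoV g z).
Proof.
apply/ffunP => i; rewrite [RHS]ffunE !free_actE mulr_sumr; apply: eq_bigr => j _.
by rewrite ffunE rmorphM scalerAr.
Qed.

Lemma free_rep_class : classC (free_rep repW gradW e_pos repV gradV).
Proof.
exists (linear_rep repW gradW), m, w, e, smul; split; first exact: w_basis.
split; first exact: w_homogeneous.
split.
  split=> [p q z|p y z|p q z|c z]; apply/ffunP => j; rewrite !ffunE.
  - by rewrite mulrDl.
  - by rewrite mulrDr.
  - by rewrite mulrA.
  by rewrite mul_mpolyC.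
split; first exact: smul_homogeneous.
split.
  exists r, (fun j => [ffun k => if k == j then 1 else 0] : Z) => z.
  exists (fun j => z j); apply/ffunP => k; rewrite free_sumE (bigD1 k) //= big1 => [|i ik].
    by rewrite !ffunE eqxx mulr1 addr0.
  by rewrite !ffunE eq_sym (negPf ik) mulr0.
move=> g M gu hM p z.
suff -> : M = rhoW g by exact: smul_equivariant.
  apply/matrixP => i j; have := congr1 (fun y : W => (y i)@_0%MM) (hM j).
  rewrite sum_basis mcoeffC eqxx mulr1 => <-; rewrite /= free_actE raddf_sum (bigD1 j) //=.
  rewrite ffunE eqxx rmorph1 mcoeffZ mcoeff1 eqxx mulr1 big1 ?addr0 // => k kj.
  by rewrite ffunE (negPf kj) raddf0 scaler0 mcoeff0.
Qed.

End FreeModuleInClass.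

(** * Virtual characters *)

Section VirtualCharacters.
Variables (K : fieldType) (n : nat).
Hypothesis charK : [pchar K] =i pred0.

Definition rep_char m (wt : 'I_m -> 'rV[int]_n) : laurent n := \sum_i tmon (wt i).

(** The representation ring of GL_n, inside the Laurent polynomials. *)
Inductive virtual_char : laurent n -> Prop :=
| virtual_rep m (rho : 'M[K]_n -> 'M[K]_m) wt : mat_rep rho wt -> virtual_char (rep_char wt)
| virtual_sub p q : virtual_char p -> virtual_char q -> virtual_char (p - q).

Lemma virtual0 : virtual_char 0.
Proof.
have h := virtual_rep (mat_rep_triv K n).
by rewrite -(subrr (rep_char (fun _ : 'I_1 => 0))); apply: virtual_sub.
Qed.

Lemma virtual1 : virtual_char 1.
Proof.
have := virtual_rep (mat_rep_triv K n).
by rewrite /rep_char big_ord_recl big_ord0 addr0 tmon0.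
Qed.

Lemma virtualN p : virtual_char p -> virtual_char (- p).
Proof. by move=> h; rewrite -sub0r; apply: virtual_sub => //; apply: virtual0. Qed.

Lemma virtualD p q : virtual_char p -> virtual_char q -> virtual_char (p + q).
Proof. by move=> hp hq; rewrite -[q]opprK; apply/virtual_sub/virtualN. Qed.

Lemma virtual_sum (I : Type) (s : seq I) (P : pred I) (F : I -> laurent n) :
  (forall i, P i -> virtual_char (F i)) -> virtual_char (\sum_(i <- s | P i) F i).
Proof. by move=> h; apply: big_ind => //; [apply: virtual0 | apply: virtualD]. Qed.

Lemma virtualMz p c : virtual_char p -> virtual_char (p *~ c).
Proof.
move=> hp; have nat_case k : virtual_char (p *+ k).
  by elim: k => [|k IH]; rewrite ?mulr0n ?mulrS; [apply: virtual0 | apply: virtualD].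
by case: c => k; rewrite ?NegzE ?mulrNz; [|apply: virtualN]; apply: nat_case.
Qed.

Lemma rep_char_tensor m1 m2 (wt1 : 'I_m1 -> 'rV[int]_n) (wt2 : 'I_m2 -> 'rV[int]_n) :
  rep_char (fun k => wt1 (mxtens_unindex k).1 + wt2 (mxtens_unindex k).2) =
  rep_char wt1 * rep_char wt2.
Proof.
rewrite /rep_char mulr_suml; under [RHS]eq_bigr do rewrite mulr_sumr.
rewrite pair_big (reindex (@mxtens_index m1 m2)).
  by apply: eq_bigr => -[i j] _; rewrite mxtens_indexK tmonD.
by exists (@mxtens_unindex m1 m2) => k _; [apply: mxtens_indexK | apply: mxtens_unindexK].
Qed.

Lemma virtualM p q : virtual_char p -> virtual_char q -> virtual_char (p * q).
Proof.
move=> hp; elim: hp q => [m1 rho1 wt1 h1|p1 p2 _ IH1 _ IH2] q hq; last first.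
  by rewrite mulrBl; apply: virtual_sub; [apply: IH1 | apply: IH2].
elim: hq => [m2 rho2 wt2 h2|q1 q2 _ IH1 _ IH2]; last first.
  by rewrite mulrBr; apply: virtual_sub; [exact: IH1 | exact: IH2].
by rewrite -rep_char_tensor; apply: virtual_rep (mat_rep_tensor h1 h2).
Qed.

Lemma virtual_exp p k : virtual_char p -> virtual_char (p ^+ k).
Proof.
move=> hp; elim: k => [|k IH]; first exact: virtual1.
by rewrite exprS; apply: virtualM.
Qed.

Lemma virtual_prod (I : Type) (s : seq I) (F : I -> laurent n) :
  (forall i, virtual_char (F i)) -> virtual_char (\prod_(i <- s) F i).
Proof. by move=> h; apply: big_ind => //; [apply: virtual1 | apply: virtualM]. Qed.

(** Permutation matrices permute the coordinates of the torus by conjugation, and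
    the trace is invariant under conjugation. *)
Lemma virtual_lsym p : virtual_char p -> lsym p.
Proof.
elim=> [m rho wt rep|p1 p2 _ h1 _ h2]; last first.
  by move=> s a; rewrite -!coef_atE !coef_atB !coef_atE h1 h2.
apply/(lsym_leval charK) => s t t0.
have trE u : (forall i, u i != 0) -> leval u (rep_char wt) = \tr (rho (torus u)).
  move=> u0; rewrite (mat_rep_torus rep u0) mxtrace_diag leval_sum.
  by apply: eq_bigr => i _; rewrite leval_tmon mxE.
rewrite !trE //; pose P : 'M[K]_n := perm_mx s.
have Pu : P \in unitmx := unitmx_perm _ s.
have tu := torus_unit t0.
have -> : torus (fun i => t (s i)) = P *m torus t *m invmx P.
  apply: (canRL (mulmxK Pu)); rewrite /torus mul_diag_mx mul_mx_diag.
  apply/matrixP => i j; rewrite !mxE.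
  by case: eqP => [<-|_]; rewrite ?mulr1 ?mul1r ?mulr0 ?mul0r.
have mP := mat_repM rep.
rewrite mP ?unitmx_inv ?unitmx_mul ?Pu // mP // mxtrace_mulC mulmxA -mP ?unitmx_inv //.
by rewrite mulVmx // (mat_rep1 rep) mul1mx.
Qed.

End VirtualCharacters.

(** * Symmetric Laurent polynomials are virtual characters *)

Section InversePowerSeries.
Variable R : comNzRingType.

Lemma inverse_coef (h : nat -> R) (D : {poly R}) d : D`_0 = 1 ->
  (forall k, smulp h D k = (1 : {poly R})`_k) ->
  D`_d = (1 : {poly R})`_d - \sum_(i < d) h i.+1 * D`_(d - i.+1).
Proof.
move=> D0 hD; have := hD 0%N; rewrite smulp_sum big_ord_recl big_ord0 addr0 subn0 D0 mulr1 coef1 => h0.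
apply/eqP; rewrite -subr_eq opprK -(hD d) smulp_sum big_ord_recl h0 mul1r subn0.
by rewrite [X in _ == X]addrC addrC.
Qed.

(** Vieta's formula. *)
Lemma prod_one_sub_coef n (x : 'I_n -> R) k :
  (\prod_i (1 - x i *: 'X))`_k =
  (-1) ^+ k * \sum_(J : {set 'I_n} | #|J| == k) \prod_(i in J) x i.
Proof.
under eq_bigr => i _ do rewrite addrC.
rewrite bigA_distr coef_sum mulr_sumr [RHS]big_mkcond /=; apply: eq_bigr => J _.
rewrite -big_mkcond /=; under eq_bigr => i _ do rewrite -scaleNr.
rewrite scaler_prod prodr_const coefZ coefXn.
have -> : \prod_(i in J) - x i = (-1) ^+ #|J| * \prod_(i in J) x i.
  by rewrite -prodr_const -big_split /=; apply: eq_bigr => i _; rewrite mulN1r.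
by rewrite eq_sym; case: eqP => [->|_]; rewrite ?mulr1 ?mulr0.
Qed.

End InversePowerSeries.

Section SymmetricAreVirtual.
Variables (K : fieldType) (n : nat).
Hypothesis charK : [pchar K] =i pred0.
Local Notation virtual := (@virtual_char K n).

(** The way back from graded representations to matrices, by which the character
    of a component counts as a virtual character. *)
Lemma comp_mat_rep (Z : gradedRep K n) d k (b : 'I_k -> Z) wt :
    is_basis (@gr_comp _ _ Z d) b ->
    (forall i, weight_vector (@gr_act _ _ Z) (wt i) (b i)) ->
  exists rho : 'M[K]_n -> 'M[K]_k, mat_rep rho wt.
Proof.
move=> bas wtb; have [GL _ cond] := gr_rational Z.
have [rho mor hrho] := cond _ _ _ bas (@gr_invariant _ _ Z d).
have [rho1 rhoM] := mx_repr_hom GL bas hrho.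
exists rho; split=> // [i j|t t0]; first exact: morphism_GL_entry.
apply/matrixP => i j; have := hrho _ (torus_unit t0) j; rewrite (wtb j t t0) => E.
have : \sum_i rho (torus t) i j *: b i = \sum_i (zpow t (wt j) *+ (i == j)) *: b i.
  rewrite -E (bigD1 j) //= eqxx mulr1n big1 ?addr0 // => l /negPf ->.
  by rewrite mulr0n scale0r.
by move/(basis_coord bas) => ->; rewrite !mxE; case: eqP => [->|].
Qed.

Section FreeModuleCharacters.
Variables (m : nat) (rhoW : 'M[K]_n -> 'M[K]_m) (wtW : 'I_m -> 'rV[int]_n) (e : 'I_m -> nat).
Hypotheses (repW : mat_rep rhoW wtW) (gradW : graded_by rhoW e) (e_pos : forall i, (0 < e i)%N).

Definition sym_denom : {poly laurent n} := \prod_i (1 - tmon (wtW i) *: 'X^(e i)).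

Lemma sym_denomE : denom [seq (wtW i, e i) | i <- enum 'I_m] = sym_denom.
Proof. by rewrite /denom big_map big_enum; apply: eq_bigr => i _; rewrite tmonE. Qed.

Lemma sym_denom0 : sym_denom`_0 = 1.
Proof. by rewrite -sym_denomE denom_coef0 //; apply/allP => _ /mapP[i _ ->]; apply: e_pos. Qed.

(** Each coefficient is the character of a component of S(W) (x) V. *)
Lemma free_char_virtual r (rhoV : 'M[K]_n -> 'M[K]_r) wtV dV d :
  mat_rep rhoV wtV -> graded_by rhoV dV -> virtual (free_char wtW e wtV dV d).
Proof.
move=> repV gradV; pose fw (x : 'I_r * 'X_{1..m}) := wtV x.1 + \sum_i wtW i *+ x.2 i.
have fwE x : free_weight wtW wtV x = tmon (fw x).
  by rewrite tmonD tmon_sum; congr (_ * _); apply: eq_bigr => i _; rewrite tmonX.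
have bas : is_basis (@gr_comp _ _ (free_rep repW gradW e_pos repV gradV) d)
  (fun i : 'I_(size (free_indices e dV d)) =>
     free_basis K (tnth (in_tuple (free_indices e dV d)) i)) by apply: free_comp_basis.
have [|rho rep] := comp_mat_rep bas (wt := fun i => fw (tnth (in_tuple (free_indices e dV d)) i)).
  by move=> i t t0; rewrite -leval_tmon -fwE; apply: free_basis_act.
have -> : free_char wtW e wtV dV d = rep_char (fun i => fw (tnth (in_tuple (free_indices e dV d)) i)).
  by rewrite /rep_char -(big_tnth _ _ _ xpredT (fun x => tmon (fw x))); apply: eq_bigr => x _; rewrite fwE.
exact: virtual_rep rep.
Qed.

(** For W in degree 1 these are, up to sign, the characters of the exterior
    powers of W.  They are obtained from the virtual characters of the components
    of S(W) by inverting the power series ch S(W). *)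
Lemma sym_denom_virtual d : virtual (sym_denom`_d).
Proof.
have repV := mat_rep_triv K n.
have gradV := @graded_by_const K n 1 (fun=> 1%:M) 0.
pose h := free_char wtW e (fun _ : 'I_1 => 0) (fun=> 0%N).
have hD k : smulp h sym_denom k = (1 : {poly laurent n})`_k.
  rewrite -sym_denomE free_char_denom //.
  by rewrite big_ord_recl big_ord0 addr0 tmon0 scale1r expr0.
elim/ltn_ind: d => d IH; rewrite (inverse_coef _ sym_denom0 hD).
apply: virtual_sub; first by rewrite coef1; case: eqP => _; [apply: virtual1 | apply: virtual0].
apply: virtual_sum => i _; apply: virtualM; first exact: free_char_virtual repV gradV.
by apply: IH; rewrite ltn_subrL /= (leq_trans _ (ltn_ord i)).
Qed.

End FreeModuleCharacters.

Local Notation unit_weight := (fun i : 'I_n => \row_j ((j == i)%:R : int) : 'rV[int]_n).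

(** The case W = K^n in degree 1, where 1 / ch S(W) is the product of the
    1 - t_i q. *)
Lemma elementary_virtual k :
  virtual (\sum_(J : {set 'I_n} | #|J| == k) \prod_(i in J) tmon (unit_weight i)).
Proof.
have := @sym_denom_virtual n (fun g => g) unit_weight (fun=> 1%N) (mat_rep_std K n)
  (@graded_by_const _ _ _ _ 1) (fun=> erefl) k.
rewrite /sym_denom prod_one_sub_coef => /(virtualM (virtual_exp k (virtualN (virtual1 K n)))).
by rewrite mulrA -exprMn mulrNN mulr1 expr1n mul1r.
Qed.

(** The N-th power of det^-1. *)
Lemma shift_virtual N : virtual (tmon (\row_i (- (N%:Z)))).
Proof.
have h : virtual (tmon (\row_i (-1 : int))).
  by have := virtual_rep (mat_rep_inv_det K n); rewrite /rep_char big_ord_recl big_ord0 addr0.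
have := virtual_exp N h; rewrite tmonX; congr (virtual (tmon _)).
by apply/rowP => i; rewrite mulmxnE !mxE mulNrn natz.
Qed.

(** The fundamental theorem writes q as an integer polynomial in the elementary
    symmetric polynomials. *)
Lemma symmetric_poly_virtual (q : {mpoly int[n]}) : q \is symmetric ->
  virtual (mmap intr (fun i => tmon (unit_weight i)) q).
Proof.
move=> /sym_fundamental[t [<- _]]; rewrite comp_mpolyEX raddf_sum /=.
apply: virtual_sum => mu _; rewrite mmapZ mulrzl; apply: virtualMz.
rewrite comp_mpolyX rmorph_prod; apply: virtual_prod => i.
rewrite rmorphXn; apply: virtual_exp; rewrite tnth_mktuple /mesym raddf_sum /=.
have := elementary_virtual i.+1; congr virtual; apply: eq_bigr => J _.
by rewrite rmorph_prod; apply: eq_bigr => j _ /=; rewrite mmapX mmap1U.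
Qed.

(** A power of t_1 ... t_n clears the negative exponents, which leaves a symmetric
    polynomial q; multiplication by a power of det^-1 then undoes the shift. *)
Lemma lsym_virtual p : lsym p -> virtual p.
Proof.
move=> psym; pose A := enum_fset (monalg.msupp p).
pose N := (\max_(a <- A) \max_i absz (a ord0 i))%N.
have Nle a i : a \in A -> (absz (a ord0 i) <= N)%N.
  move=> aA; apply: leq_trans (leq_bigmax_seq (F := fun a : 'rV[int]_n => \max_i absz (a ord0 i)) _ aA isT).
  exact: (leq_bigmax (F := fun i => absz (a ord0 i))).
pose up (a : 'rV[int]_n) : 'X_{1..n} := [multinom absz (a ord0 i + N%:Z)%R | i < n].
pose down (mu : 'X_{1..n}) : 'rV[int]_n := \row_i ((mu i)%:Z - N%:Z).
have upK a : a \in A -> down (up a) = a.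
  move=> aA; apply/rowP => i; rewrite mxE mnmE gez0_abs ?addrK //.
  by rewrite -lerBlDr sub0r lerNl; apply: le_trans (lez_abs _) _; rewrite abszN lez_nat Nle.
have downK mu : up (down mu) = mu by apply/mnmP => i; rewrite mnmE mxE subrK.
pose q : {mpoly int[n]} := \sum_(a <- A) lcoef p a *: 'X_[up a].
have qE mu : q@_mu = lcoef p (down mu).
  rewrite /q raddf_sum /=; under eq_bigr do rewrite mcoeffZ mcoeffX.
  have [dA|dA] := boolP (down mu \in A).
    rewrite (bigD1_seq (down mu)) ?fset_uniq //= downK eqxx mulr1 big_seq_cond big1 ?addr0 //.
    move=> a /andP[aA /negPf ad]; case: eqP => [E|_]; last by rewrite mulr0.
    by rewrite -E upK ?eqxx in ad.
  rewrite big_seq big1 => [|a aA].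
    by have /monalg.mcoeff_outdom : down mu \notin monalg.msupp p by [].
  case: eqP => [E|_]; last by rewrite mulr0.
  by rewrite -E upK ?aA in dA.
have qsym : q \is symmetric.
  apply/issymP => s; apply/mpolyP => mu; rewrite mcoeff_sym !qE.
  rewrite -[RHS](psym s); congr (lcoef p _); apply/rowP => i; rewrite !mxE.
  by rewrite mnmE.
have qp : mmap intr (fun i => tmon (unit_weight i)) q = tmon (\row_i N%:Z) * p.
  rewrite /q raddf_sum /= [in RHS](laurent_tmonE p) mulr_sumr.
  rewrite big_seq [RHS]big_seq; apply: eq_bigr => a aA.
  rewrite mmapZ mmapX mulrzl coef_atE mulrzAr -tmonD.
  suff -> : mmap1 (fun i => tmon (unit_weight i)) (up a) = tmon (\row_i N%:Z + a) by [].
  rewrite /mmap1; under eq_bigr do rewrite tmonX; rewrite -tmon_sum; congr tmon.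
  apply/rowP => i; rewrite summxE (bigD1 i) //= big1 => [|j ji].
    have /rowP/(_ i) := upK a aA; rewrite mulmxnE !mxE eqxx addr0 => /(canRL (subrK _)) E.
    by rewrite addrC -E mulr1n natz.
  by rewrite mulmxnE mxE eq_sym (negPf ji) mul0rn.
have -> : p = tmon (\row_i (- N%:Z)) * (tmon (\row_i N%:Z) * p).
  rewrite mulrA -tmonD.
  have -> : \row_i (- N%:Z) + \row_i N%:Z = 0 :> 'rV[int]_n.
    by apply/rowP => i; rewrite !mxE addNr.
  by rewrite tmon0 mul1r.
by rewrite -qp; apply: virtualM; [apply: shift_virtual | apply: symmetric_poly_virtual].
Qed.

End SymmetricAreVirtual.

(** * Rational symmetric series are combinations of characters *)

Section SpanClosure.
Variables (n : nat) (S : pseries n -> Prop).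

Lemma in_Zspan_ext f g : f =1 g -> in_Zspan S f -> in_Zspan S g.
Proof. by move=> fg [N [c [h [Sh fE]]]]; exists N, c, h; split=> // d; rewrite -fg. Qed.

Lemma in_Zspan_gen f : S f -> in_Zspan S f.
Proof.
move=> Sf; exists 1%N, (fun=> 1), (fun=> f); split=> // d.
by rewrite big_ord_recl big_ord0 addr0.
Qed.

Lemma in_Zspan0 : in_Zspan S (fun=> 0).
Proof. by exists 0%N, (fun=> 0), (fun=> fun=> 0); split=> [[]|d] //; rewrite big_ord0. Qed.

Lemma in_ZspanD f g : in_Zspan S f -> in_Zspan S g -> in_Zspan S (fun d => f d + g d).
Proof.
move=> [N [c [h [Sh fE]]]] [N' [c' [h' [Sh' gE]]]].
exists (N + N')%N, (sum_case c c'), (sum_case h h'); split=> [i|d].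
  by rewrite /sum_case; case: split.
rewrite fE gE big_split_ord /=; congr (_ + _); apply: eq_bigr => i _.
  by rewrite /sum_case (unsplitK (inl i)).
by rewrite /sum_case (unsplitK (inr i)).
Qed.

Lemma in_ZspanN f : in_Zspan S f -> in_Zspan S (fun d => - f d).
Proof.
move=> [N [c [h [Sh fE]]]]; exists N, (fun i => - c i), h; split=> // d.
by rewrite fE -sumrN; apply: eq_bigr => i _; rewrite mulrNz.
Qed.

Lemma in_Zspan_sum N (F : nat -> pseries n) : (forall k, in_Zspan S (F k)) ->
  in_Zspan S (fun d => \sum_(k < N) F k d).
Proof.
move=> h; elim: N => [|N IH].
  by apply: in_Zspan_ext in_Zspan0 => d; rewrite big_ord0.
by apply: in_Zspan_ext (in_ZspanD IH (h N)) => d; rewrite big_ord_recr.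
Qed.

End SpanClosure.

Section Converse.
Variables (K : fieldType) (n : nat).
Hypothesis charK : [pchar K] =i pred0.

Local Notation class_char :=
  (fun chi : pseries n => exists Z : gradedRep K n, classC Z /\ graded_char Z chi).

(** Multiplication by a factor 1 - t^a acts on each coefficient in q separately,
    and injectively since a <> 0: a product that vanishes in high degrees comes
    from a series that does. *)
Lemma strip_degree0 s f (P : {poly laurent n}) : denom s != 0 :> {poly laurent n} ->
    smulp f (denom s) =1 (fun d => P`_d) ->
  exists P' : {poly laurent n},
    smulp f (denom [seq ak <- s | (0 < ak.2)%N]) =1 (fun d => P'`_d).
Proof.
elim: s f P => [|[a k] s IH] f P; first by exists P.
rewrite denom_cons /= => s0 fP.
have s0' : denom s != 0 :> {poly laurent n} by apply: contraNneq s0 => ->; rewrite mulr0.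
case: k s0 fP => [|k] s0 fP; last first.
  have [P' hP'] := IH (smulp f (1 - tmon a *: 'X^(k.+1))) P s0' (fun d => etrans (smulpA _ _ _ _) (fP d)).
  by exists P' => d; rewrite denom_cons -smulpA.
have a0 : a != 0 by apply: contraNneq s0 => ->; rewrite tmon0 scale1r subrr mul0r.
apply: (IH f (\poly_(d < size P) smulp f (denom s) d) s0') => d.
rewrite coef_poly; case: ltnP => // dP; apply: (one_sub_mon_regular a0).
have := fP d; rewrite mulrC -smulpA smulpBr smulp1 smulp_monX subn0 (nth_default 0 dP) /= => E.
by rewrite mulrBl mul1r.
Qed.

(** For N large, a + (N, ..., N) has no negative entry, so it is a weight of a
    tensor power of the standard representation; det^-1 has weight
    (-1, ..., -1). *)
Lemma weight_occurs (a : 'rV[int]_n) : exists m (rho : 'M[K]_n -> 'M[K]_m) wt,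
  mat_rep rho wt /\ exists i, wt i = a.
Proof.
pose occurs a := exists m (rho : 'M[K]_n -> 'M[K]_m) wt, mat_rep rho wt /\ exists i, wt i = a.
have occ0 : occurs 0.
  by exists 1%N, (fun=> 1%:M), (fun=> 0); split; [apply: mat_rep_triv | exists ord0].
have occD b c : occurs b -> occurs c -> occurs (b + c).
  move=> [m1 [r1 [w1 [h1 [i1 <-]]]]] [m2 [r2 [w2 [h2 [i2 <-]]]]].
  do 3!eexists; split; first exact: mat_rep_tensor h1 h2.
  by exists (mxtens_index (i1, i2)); rewrite mxtens_indexK.
have occMn b k : occurs b -> occurs (b *+ k).
  by move=> hb; elim: k => [|k IH]; rewrite ?mulr0n // mulrS; apply: occD.
have occ_unit i : occurs (\row_j ((j == i)%:R : int)).
  by do 3!eexists; split; [apply: mat_rep_std | exists i].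
have occ_det : occurs (\row_i (-1 : int)).
  by do 3!eexists; split; [apply: mat_rep_inv_det | exists ord0].
pose N := (\max_i absz (a ord0 i))%N.
have -> : a = \sum_i (\row_j ((j == i)%:R : int)) *+ absz (a 0 i + N%:Z) + (\row_i (-1 : int)) *+ N.
  apply/rowP => i; rewrite mxE summxE mulmxnE mxE (bigD1 i) //= big1 => [|j ji].
    rewrite mulmxnE mxE eqxx mulr1n addr0 natz gez0_abs; first by rewrite mulNrn natz addrK.
    rewrite -lerBlDr sub0r lerNl; apply: le_trans (lez_abs _) _; rewrite abszN lez_nat.
    exact: (leq_bigmax (F := fun i => absz (a ord0 i))).
  by rewrite mulmxnE mxE eq_sym (negPf ji) mul0rn.
apply: (occD _ _ _ (occMn _ _ occ_det)).
by apply: (big_ind occurs) => [|b c|i _]; [exact: occ0 | exact: occD | exact: occMn].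
Qed.

(** Take for W the sum, over the factors 1 - t^a q^k, of representations in which
    the weight a occurs, placed in degree k. *)
Lemma denom_divides_sym_denom s : all (fun ak : 'rV[int]_n * nat => 0 < ak.2)%N s ->
  exists m (rho : 'M[K]_n -> 'M[K]_m) wt (e : 'I_m -> nat) (R : {poly laurent n}),
    [/\ mat_rep rho wt, graded_by rho e, forall i, (0 < e i)%N & sym_denom wt e = denom s * R].
Proof.
elim: s => [_|[a k] s IH /= /andP[k0 s0]].
  exists 0%N, (fun _ => 0), (fun=> 0), (fun=> 0%N), 1; split; first exact: mat_rep_zero.
  - exact: graded_by_zero.
  - by case.
  by rewrite /sym_denom /denom big_ord0 big_nil mulr1.
have [m1 [r1 [w1 [e1 [R [h1 g1 p1 E1]]]]]] := IH s0.
have [m2 [r2 [w2 [h2 [i wi]]]]] := weight_occurs a.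
exists (m2 + m1)%N, (fun g => block_mx (r2 g) 0 0 (r1 g)), (sum_case w2 w1).
exists (sum_case (fun=> k) e1), (\prod_(j | j != i) (1 - tmon (w2 j) *: 'X^k) * R); split.
- exact: mat_rep_sum.
- exact/graded_by_sum/g1/graded_by_const.
- by move=> j; rewrite /sum_case; case: split.
have lc T (f : 'I_m2 -> T) f' j : sum_case f f' (lshift m1 j) = f j.
  by rewrite /sum_case (unsplitK (inl j)).
have rc T (f : 'I_m2 -> T) f' j : sum_case f f' (rshift m2 j) = f' j.
  by rewrite /sum_case (unsplitK (inr j)).
rewrite /sym_denom big_split_ord /=.
under eq_bigr => j _ do rewrite !lc.
under [X in _ * X]eq_bigr => j _ do rewrite !rc.
by rewrite -/(sym_denom w1 e1) E1 (bigD1 i) //= wi denom_cons mulrACA.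
Qed.

(** With S(W) (x) V placed in degree k, a virtual character p yields p q^k / D,
    where 1 / D = ch S(W). *)
Lemma virtual_over_sym_denom m (rho : 'M[K]_n -> 'M[K]_m) wt (e : 'I_m -> nat) k p :
    mat_rep rho wt -> graded_by rho e -> (forall i, (0 < e i)%N) -> virtual_char K p ->
  exists2 h, in_Zspan class_char h &
    smulp h (sym_denom wt e) =1 (fun d => (p *: 'X^k : {poly laurent n})`_d).
Proof.
move=> rep grad pos; elim=> [r rhoV wtV repV|p1 p2 _ [h1 s1 E1] _ [h2 s2 E2]].
  have gradV := @graded_by_const K n r rhoV k.
  exists (free_char wt e wtV (fun=> k)).
    apply: in_Zspan_gen; exists (free_rep rep grad pos repV gradV); split.
      exact: free_rep_class.
    exact: free_rep_char.
  by move=> d; rewrite -sym_denomE free_char_denom // -scaler_suml.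
exists (fun d => h1 d + - h2 d); first by apply: in_ZspanD => //; apply: in_ZspanN.
move=> d; rewrite smulpDl.
have -> : smulp (fun i => - h2 i) (sym_denom wt e) d = - smulp h2 (sym_denom wt e) d.
  by rewrite !smulp_sum -sumrN; apply: eq_bigr => i _; rewrite mulNr.
by rewrite E1 E2 scalerBl coefB.
Qed.

(** With 1 / D = ch S(W) a multiple of 1 / denom, the polynomial Q = f D has
    symmetric coefficients, hence f = Q / D is a sum of series p q^k / D with
    virtual characters p. *)
Lemma rational_in_span (f : pseries n) s (P : {poly laurent n}) :
    (forall d, lsym (f d)) -> denom s != 0 :> {poly laurent n} ->
    smulp f (denom s) =1 (fun d => P`_d) ->
  in_Zspan class_char f.
Proof.
move=> fsym s0 fP.
have [P' fP'] := strip_degree0 s0 fP.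
have pos : all (fun ak => 0 < ak.2)%N [seq ak <- s | (0 < ak.2)%N] by apply: filter_all.
have [m [rho [wt [e [R [rep grad epos DE]]]]]] := denom_divides_sym_denom pos.
set D := sym_denom wt e in DE.
pose Q := P' * R.
have fQ : smulp f D =1 (fun d => Q`_d).
  by move=> d; rewrite DE -smulpA (eq_smulp _ fP') smulp_poly.
have Qvirt k : virtual_char K Q`_k.
  apply: lsym_virtual; rewrite -fQ smulp_sum; apply: lsym_sum => i.
  by apply: (lsymM charK) => //; apply: (virtual_lsym charK); apply: sym_denom_virtual rep grad epos _.
have /choice[h hh] : forall k, exists h, in_Zspan class_char h /\
    smulp h D =1 (fun d => (Q`_k *: 'X^k : {poly laurent n})`_d).
  by move=> k; have [h ? ?] := virtual_over_sym_denom k rep grad epos (Qvirt k); exists h.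
apply: in_Zspan_ext (in_Zspan_sum (size Q) (fun k => proj1 (hh k))).
apply: (smulp_cancel (sym_denom0 wt epos)) => d.
rewrite fQ smulp_sum; under eq_bigr => i _ do rewrite mulr_suml.
rewrite exchange_big -[Q in RHS]coefK poly_def coef_sum; apply: eq_bigr => k _.
by rewrite -smulp_sum (proj2 (hh k)).
Qed.

End Converse.

Theorem proposition2p2 (K : fieldType) (n : nat) (f : pseries n)
    (charK : [pchar K] =i pred0)
    (f_sym : forall d : nat, lsym (f d)) :
  in_Zspan
    (fun chi : pseries n => exists Z : gradedRep K n, classC Z /\ graded_char Z chi) f
  <->
  exists (P : {poly laurent n}) (s : seq ('rV[int]_n * nat)),
    denom s != 0 /\
    (forall d : nat, pser_mul f (pser_of_poly (denom s)) d = pser_of_poly P d).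
Proof.
split=> [[N [c [h [hC fE]]]]|[P [s [s0 fP]]]]; last first.
  apply: (rational_in_span charK f_sym s0 (P := P)) => d.
  by rewrite -smulp_pser; apply: fP.
have [|s [P [pos fP]]] := rational_combination (n := n) (f := f) _ fE.
  by move=> i; have [Z [ZC chi]] := hC i; apply: (class_char_rational charK ZC chi).
exists P, s; split=> [|d]; last by rewrite smulp_pser fP.
apply: contraTneq (oner_neq0 (laurent n)) => s0.
by rewrite negbK -(denom_coef0 pos) s0 coef0.
Qed.
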